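(* Assume $F=\begin{bmatrix} I_r&0_{r\times(n-r)}\\0_{(m-r)\times r}&0_{(m-r)\times(n-r)}\end{bmatrix}\in\mathbb R^{m\times n}$. Let $\varepsilon>0$ and $\ell=\begin{pmatrix}\ell_1\\ \ell_2\end{pmatrix}\in\mathbb R^m$ with $\ell_1\in\mathbb R^r$. Let $\hat u_\varepsilon$ be the sub-optimal $\ell$-estimate, and let $K(t,\varepsilon)$, $\Phi(t,\varepsilon)$, $z_1$ and $\hat x_\varepsilon$ be the functions defined in the context. Then $$\hat u_\varepsilon(y)=\int_{t_0}^T\langle\hat u_\varepsilon,y\rangle dt=\big\langle\varepsilon^{-1}(I_r+K(T,\varepsilon))^{-1}\hat x_\varepsilon(T),\ \ell_1\big\rangle,$$ and the sub-optimal $\ell$-error is given by $$\hat\sigma^\varepsilon(T,\ell)=\frac1\varepsilon\Big[\langle z_1(T),K(T,\varepsilon)z_1(T)\rangle-\int_{t_0}^T\|\Phi(t,\varepsilon)z_1(t)\|^2dt\Big].$$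
   Context: Notation. A prime denotes the transpose of a matrix, $F^+$ is the Moore–Penrose pseudoinverse, $Q^{\frac12}$ is the square root of a symmetric nonnegative matrix, $\|\cdot\|$ is the Euclidean norm. $\mathbb L_2(t_0,T,\mathbb R^k)$ (abbreviated $\mathbb L_2$) is the space of square-integrable $\mathbb R^k$-valued functions on $[t_0,T]$, and $\mathbb H_1(t_0,T,\mathbb R^k)$ is the space of absolutely continuous $\mathbb R^k$-valued functions with derivative in $\mathbb L_2$. Data. $t_0<T$ are real numbers; $F\in\mathbb R^{m\times n}$ is constant; $C(t)\in\mathbb R^{m\times n}$ and $H(t)\in\mathbb R^{p\times n}$ are continuous in $t\in[t_0,T]$; $Q_0,Q(t)\in\mathbb R^{m\times m}$ and $R(t)\in\mathbb R^{p\times p}$ are symmetric positive definite, with $Q(t),Q^{-1}(t),R(t),R^{-1}(t)$ continuous on $[t_0,T]$. The function $y(t)\in\mathbb R^p$ is a (square-integrable) realization of the observations $y(t)=H(t)x(t)+\eta(t)$, $t\in[t_0,T]$, where $x$ is a solution of $\frac{d(Fx)}{dt}=C(t)x(t)+f(t)$, $Fx(t_0)=x_0$, and $\eta$ is a realization of a zero-mean random noise process with $\int_{t_0}^T\mathrm{tr}\,(R(t)\,E\eta(t)\eta'(t))dt\le1$. Sub-optimal estimate and error. For $\varepsilon>0$ and $\ell\in\mathbb R^m$ let $(\hat u_\varepsilon,\hat p_\varepsilon,\hat z_\varepsilon,\hat d_\varepsilon)$ be the unique solution $(u,p,z,d)$ of $$\begin{aligned} &\frac{d(F'z)}{dt}=-C'z+H'u+p,\qquad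 \frac{d(Fp)}{dt}=Cp+\varepsilon Q^{-1}z,\qquad \varepsilon u=RHp,\\ &F'z(T)+F^+Fp(T)=F'\ell,\qquad F'd=0,\qquad \frac1\varepsilon Fp(t_0)=Q_0^{-1}\big((F')^+F'z(t_0)-d\big), \end{aligned}$$ where $u\in\mathbb L_2(t_0,T,\mathbb R^p)$, $p\in\mathbb L_2(t_0,T,\mathbb R^n)$ with $Fp\in\mathbb H_1$, $z\in\mathbb L_2(t_0,T,\mathbb R^m)$ with $F'z\in\mathbb H_1$, $d\in\mathbb R^m$ (equations hold almost everywhere). $\hat u_\varepsilon$ is called the sub-optimal $\ell$-estimate, and $\hat u_\varepsilon(y):=\int_{t_0}^T\langle\hat u_\varepsilon(t),y(t)\rangle dt$. The sub-optimal $\ell$-error is $$\hat\sigma^\varepsilon(T,\ell):=\Omega(\hat u_\varepsilon,\hat z_\varepsilon,\hat d_\varepsilon),\qquad \Omega(u,z,d)=\|R^{-\frac12}u\|_{\mathbb L_2}^2+\|Q_0^{-\frac12}((F')^+F'z(t_0)-d)\|^2+\|Q^{-\frac12}z\|_{\mathbb L_2}^2.$$ Block matrices (with $r=\mathrm{rank}\,F$). Write $$C(t)=\begin{bmatrix}C_1&C_2\\C_3&C_4\end{bmatrix},\quad Q^{-1}(t)=\begin{bmatrix}Q_1&Q_2\\Q_2'&Q_4\end{bmatrix},\quad Q_0^{-1}=\begin{bmatrix}Q_1^0&Q_2^0\\(Q_2^0)'&Q_4^0\end{bmatrix},\quad H'RH=\begin{bmatrix}S_1&S_2\\S_2'&S_4\end{bmatrix},$$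 where the upper-left blocks are $r\times r$. If $n=r$ or $m=r$ the corresponding blocks are empty, and all terms below that involve an empty block are omitted (taken as zero). Define $$\begin{aligned} &\widetilde Q_4=Q_1^0-Q_2^0(Q_4^0)^{-1}(Q_2^0)',\\ &W(t,\varepsilon)=\varepsilon I_{n-r}+S_4+C_4'Q_4^{-1}C_4,\qquad M(t,\varepsilon)=W^{-1}(t,\varepsilon),\\ &A(t)=C_3'Q_4^{-1}C_4+S_2,\qquad B(t)=C_2'-C_4'Q_4^{-1}Q_2',\\ &C_\varepsilon(t)=-C_1'+C_3'Q_4^{-1}Q_2'+A(t)M(t,\varepsilon)B(t),\\ &Q_\varepsilon(t)=-\tfrac1\varepsilon A(t)M(t,\varepsilon)A'(t)+I_r+\tfrac1\varepsilon\big[S_1+C_3'Q_4^{-1}C_3\big],\\ &S_\varepsilon(t)=\varepsilon\big(Q_1-Q_2Q_4^{-1}Q_2'+B'(t)M(t,\varepsilon)B(t)\big). \end{aligned}$$ Filter. $K(t,\varepsilon)\in\mathbb R^{r\times r}$ solves on $[t_0,T]$ the Riccati equation $$\frac{dK}{dt}=-KC_\varepsilon-C_\varepsilon'K-KQ_\varepsilon K+S_\varepsilon,\qquad K(t_0,\varepsilon)=\varepsilon\widetilde Q_4,$$ and $$\Phi(t,\varepsilon)=\begin{bmatrix}K(t,\varepsilon)\\ M(t,\varepsilon)\big[\varepsilon B(t)-A'(t)K(t,\varepsilon)\big]\end{bmatrix}\in\mathbb R^{n\times r}.$$ The function $z_1$ solves $$\frac{dz_1}{dt}=C_\varepsilon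 z_1+Q_\varepsilon K(t,\varepsilon)z_1,\qquad z_1(T)=(I_r+K(T,\varepsilon))^{-1}\ell_1,$$ and $\hat x_\varepsilon$ solves the linear equation driven by the realization $y$, $$d\hat x_\varepsilon=\big[-C_\varepsilon'-K(t,\varepsilon)Q_\varepsilon\big]\hat x_\varepsilon\,dt+\Phi'(t,\varepsilon)H'(t)R(t)y(t)\,dt,\qquad \hat x_\varepsilon(t_0)=0.$$ *)

(* Defs.v *)
From HB Require Import structures.
From mathcomp Require Import all_boot all_order all_algebra.
From mathcomp Require Import all_classical all_reals all_analysis.

Set Implicit Arguments.
Unset Strict Implicit.
Unset Printing Implicit Defensive.

Import Order.TTheory GRing.Theory Num.Theory.
Import numFieldNormedType.Exports.

Local Open Scope classical_set_scope.
Local Open Scope ring_scope.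

(* 'cV[R]_k stands for R^k. The library norm of a matrix is the sup norm, so
   the Euclidean one is defined here. *)
Definition dotv (R : realType) (k : nat) (u v : 'cV[R]_k) : R :=
  \sum_(i < k) u i ord0 * v i ord0.

Definition enorm (R : realType) (k : nat) (u : 'cV[R]_k) : R :=
  Num.sqrt (dotv u u).

Definition posdef (R : realType) (k : nat) (A : 'M[R]_k) : Prop :=
  A^T = A /\ forall x : 'cV[R]_k, x != 0 -> 0 < dotv x (A *m x).

Definition possemidef (R : realType) (k : nat) (A : 'M[R]_k) : Prop :=
  A^T = A /\ forall x : 'cV[R]_k, 0 <= dotv x (A *m x).

(* The nonnegative square root of a symmetric nonnegative matrix (0 when A is
   not such a matrix). *)
Definition sqrtmx (R : realType) (k : nat) (A : 'M[R]_k) : 'M[R]_k :=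
  xget 0 [set S | possemidef S /\ S *m S = A].

(* The four Penrose equations. The library's pinvmx is only a one-sided partial
   inverse, not the Moore-Penrose one. *)
Definition penrose (R : realType) (m n : nat) (F : 'M[R]_(m, n))
    (G : 'M[R]_(n, m)) : Prop :=
  [/\ F *m G *m F = F, G *m F *m G = G,
      (F *m G)^T = F *m G & (G *m F)^T = G *m F].

Definition mpinv (R : realType) (m n : nat) (F : 'M[R]_(m, n)) : 'M[R]_(n, m) :=
  xget 0 [set G | penrose F G].

Section function_spaces.
Context {R : realType}.
Local Notation mu := (@lebesgue_measure R).

(* Elements of L2 and H1 are represented by functions R -> R^k, of which only
   the values on [a, b] matter. *)
Definition inL2 (a b : R) (k : nat) (f : R -> 'cV[R]_k) : Prop :=
  (forall i, measurable_fun `[a, b] (fun t => f t i ord0)) /\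
  mu.-integrable `[a, b] (fun t => (enorm (f t) ^+ 2)%:E).

Definition abs_continuous (V : normedModType R) (a b : R) (f : R -> V) : Prop :=
  forall e : R, 0 < e -> exists2 d : R, 0 < d &
    forall (N : nat) (s t : 'I_N -> R),
      (forall i, [/\ a <= s i, s i <= t i & t i <= b]) ->
      trivIset setT (fun i => `]s i, t i[%classic) ->
      \sum_(i < N) (t i - s i) < d ->
      \sum_(i < N) `|f (t i) - f (s i)| < e.

Definition derives_ae (V : normedModType R) (a b : R) (f g : R -> V) : Prop :=
  {ae mu, forall t, t \in `[a, b] -> is_derive t 1 f (g t)}.

Definition inH1 (a b : R) (k : nat) (f : R -> 'cV[R]_k) : Prop :=
  abs_continuous a b f /\ exists2 g, inL2 a b g & derives_ae a b f g.

(* f' = g on [a, b] in the sense of Caratheodory; in applications the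
   right-hand side g depends on f. For a right-hand side that is continuous in
   time this is the classical notion of solution. *)
Definition ode_solution (V : normedModType R) (a b : R) (f g : R -> V) : Prop :=
  abs_continuous a b f /\ derives_ae a b f g.

End function_spaces.

Section observations.
Context {R : realType}.
Local Notation mu := (@lebesgue_measure R).

Definition correlation d (Om : measurableType d) (P : probability Om R)
    (p : nat) (X : Om -> 'cV[R]_p) : 'M[R]_p :=
  \matrix_(i, j) fine ('E_P[fun w => (X w i ord0 * X w j ord0)%R])%E.

Record noise_process (t0 T : R) (p : nat) (Rw : R -> 'M[R]_p)
    d (Om : measurableType d) (P : probability Om R)
    (eta : R -> Om -> 'cV[R]_p) : Prop := {
  noise_measurable : forall i,
    measurable_fun (`[t0, T] `*` [set: Om]) (fun tw => eta tw.1 tw.2 i ord0) ;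
  noise_L2 : forall t i, t \in `[t0, T] ->
    (fun w => eta t w i ord0) \in Lfun P 2%:E ;
  noise_centered : forall t i, t \in `[t0, T] ->
    ('E_P[fun w => eta t w i ord0] = 0)%E ;
  noise_bounded :
    (\int[mu]_(t in `[t0, T]) (\tr (Rw t *m correlation P (eta t)))%:E <= 1)%E
}.

(* y is a square-integrable realization (at the elementary event w) of the
   observations of some state x of the descriptor system. *)
Definition observation (t0 T : R) (m n p : nat) (F : 'M[R]_(m, n))
    (C : R -> 'M[R]_(m, n)) (H : R -> 'M[R]_(p, n)) (Rw : R -> 'M[R]_p)
    (y : R -> 'cV[R]_p) : Prop :=
  inL2 t0 T y /\
  exists (x : R -> 'cV[R]_n) (f : R -> 'cV[R]_m) (x0 : 'cV[R]_m),
    [/\ inL2 t0 T x /\ inH1 t0 T (fun t => F *m x t),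
        inL2 t0 T f,
        derives_ae t0 T (fun t => F *m x t) (fun t => C t *m x t + f t),
        F *m x t0 = x0 &
        exists d (Om : measurableType d) (P : probability Om R)
            (eta : R -> Om -> 'cV[R]_p) (w : Om),
          noise_process t0 T Rw P eta /\
          {ae mu, forall t, t \in `[t0, T] -> y t = H t *m x t + eta t w}].

End observations.

Section suboptimal_estimate.
Context {R : realType}.
Local Notation mu := (@lebesgue_measure R).

(* q is the unknown function written p in the mathematical text (here p is the
   dimension of the observations), and Rw is the weight written R there.
   z and q are the representatives of their L2 classes for which F'z and Fq are
   absolutely continuous everywhere on [t0, T], so that the boundary values
   F'z(t0), F'z(T), Fq(t0), Fq(T) are those of the H1 functions. *)
Record suboptimal_solution (t0 T : R) (m n p : nat) (F : 'M[R]_(m, n))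
    (C : R -> 'M[R]_(m, n)) (H : R -> 'M[R]_(p, n)) (Q0 : 'M[R]_m)
    (Q : R -> 'M[R]_m) (Rw : R -> 'M[R]_p) (eps : R) (l : 'cV[R]_m)
    (u : R -> 'cV[R]_p) (q : R -> 'cV[R]_n) (z : R -> 'cV[R]_m)
    (d : 'cV[R]_m) : Prop := {
  so_u_L2 : inL2 t0 T u ;
  so_q_L2 : inL2 t0 T q ;
  so_Fq_H1 : inH1 t0 T (fun t => F *m q t) ;
  so_z_L2 : inL2 t0 T z ;
  so_Fz_H1 : inH1 t0 T (fun t => F^T *m z t) ;
  so_z_eq : derives_ae t0 T (fun t => F^T *m z t)
    (fun t => - (C t)^T *m z t + (H t)^T *m u t + q t) ;
  so_q_eq : derives_ae t0 T (fun t => F *m q t)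
    (fun t => C t *m q t + eps *: (invmx (Q t) *m z t)) ;
  so_u_eq : {ae mu, forall t, t \in `[t0, T] ->
    eps *: u t = Rw t *m H t *m q t} ;
  so_final : F^T *m z T + mpinv F *m (F *m q T) = F^T *m l ;
  so_d : F^T *m d = 0 ;
  so_initial : eps^-1 *: (F *m q t0)
    = invmx Q0 *m (mpinv F^T *m (F^T *m z t0) - d)
}.

Definition estimate (t0 T : R) (p : nat) (u y : R -> 'cV[R]_p) : R :=
  \int[mu]_(t in `[t0, T]) dotv (u t) (y t).

(* Q^(-1/2) is the square root of Q^(-1). *)
Definition Omega (t0 T : R) (m n p : nat) (F : 'M[R]_(m, n)) (Q0 : 'M[R]_m)
    (Q : R -> 'M[R]_m) (Rw : R -> 'M[R]_p)
    (u : R -> 'cV[R]_p) (z : R -> 'cV[R]_m) (d : 'cV[R]_m) : R :=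
  \int[mu]_(t in `[t0, T]) enorm (sqrtmx (invmx (Rw t)) *m u t) ^+ 2
  + enorm (sqrtmx (invmx Q0) *m (mpinv F^T *m (F^T *m z t0) - d)) ^+ 2
  + \int[mu]_(t in `[t0, T]) enorm (sqrtmx (invmx (Q t)) *m z t) ^+ 2.

End suboptimal_estimate.

(* The sizes are m = r + a and n = r + b. Empty blocks (a = 0 or b = 0) are
   matrices with no rows or no columns: the products going through them are
   zero. *)
Section blocks.
Context {R : realType} {r a b p : nat}.
Variables (C : R -> 'M[R]_(r + a, r + b)) (H : R -> 'M[R]_(p, r + b)).
Variables (Q : R -> 'M[R]_(r + a)) (Rw : R -> 'M[R]_p).
Variables (eps t : R).

Let C1 : 'M[R]_(r, r) := ulsubmx (C t).
Let C2 : 'M[R]_(r, b) := ursubmx (C t).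
Let C3 : 'M[R]_(a, r) := dlsubmx (C t).
Let C4 : 'M[R]_(a, b) := drsubmx (C t).

Let Q1 : 'M[R]_(r, r) := ulsubmx (invmx (Q t)).
Let Q2 : 'M[R]_(r, a) := ursubmx (invmx (Q t)).
Let Q4 : 'M[R]_(a, a) := drsubmx (invmx (Q t)).

Let S : 'M[R]_(r + b, r + b) := (H t)^T *m Rw t *m H t.
Let S1 : 'M[R]_(r, r) := ulsubmx S.
Let S2 : 'M[R]_(r, b) := ursubmx S.
Let S4 : 'M[R]_(b, b) := drsubmx S.

Definition Wmx : 'M[R]_b := eps%:M + S4 + C4^T *m invmx Q4 *m C4.

Definition Mmx : 'M[R]_b := invmx Wmx.

Definition Amx : 'M[R]_(r, b) := C3^T *m invmx Q4 *m C4 + S2.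

Definition Bmx : 'M[R]_(b, r) := C2^T - C4^T *m invmx Q4 *m Q2^T.

Definition Ceps : 'M[R]_r :=
  - C1^T + C3^T *m invmx Q4 *m Q2^T + Amx *m Mmx *m Bmx.

Definition Qeps : 'M[R]_r :=
  - (eps^-1 *: (Amx *m Mmx *m Amx^T)) + 1%:M
  + eps^-1 *: (S1 + C3^T *m invmx Q4 *m C3).

Definition Seps : 'M[R]_r :=
  eps *: (Q1 - Q2 *m invmx Q4 *m Q2^T + Bmx^T *m Mmx *m Bmx).

Definition Phi (K : R -> 'M[R]_r) : 'M[R]_(r + b, r) :=
  col_mx (K t) (Mmx *m (eps *: Bmx - Amx^T *m K t)).

End blocks.

Definition Q4tilde (R : realType) (r a : nat) (Q0 : 'M[R]_(r + a)) : 'M[R]_r :=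
  let Q01 : 'M[R]_(r, r) := ulsubmx (invmx Q0) in
  let Q02 : 'M[R]_(r, a) := ursubmx (invmx Q0) in
  let Q04 : 'M[R]_(a, a) := drsubmx (invmx Q0) in
  Q01 - Q02 *m invmx Q04 *m Q02^T.

(* Main.v *)
Require Import Defs.
From HB Require Import structures.
From mathcomp Require Import all_boot all_order all_algebra.
From mathcomp Require Import all_classical all_reals all_analysis.
From mathcomp Require Import measurable_realfun ring lra.
From mathcomp.real_closed Require complex.

Set Implicit Arguments.
Unset Strict Implicit.
Unset Printing Implicit Defensive.

Import Order.TTheory GRing.Theory Num.Theory.
Import numFieldNormedType.Exports.

Local Open Scope classical_set_scope.
Local Open Scope ring_scope.

(** The estimate is the component u of a two-point boundary value problem for
the pair (z, q).  As F is a block identity, the lower rows of the two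
differential equations have left-hand side zero: they are algebraic equations,
and they express the lower blocks of z and q through the upper blocks z1 and q1
(eliminate_vector).  The matrix to invert for this is W, which is positive
definite because of its term eps I.  What remains is a Hamiltonian system

  z1' = Ceps z1 + Qeps q1,      q1' = - Ceps^T q1 + Seps z1,

with q1(t0) = K(t0) z1(t0) (eliminate_initial).  The Riccati equation is
exactly the condition under which w = q1 - K z1 solves the homogeneous linear
equation w' = - (Ceps^T + K Qeps) w.  Since w(t0) = 0, uniqueness gives
q1 = K z1, hence q = Phi z1 almost everywhere.  The final condition becomes
(I + K(T)) z1(T) = l1, so uniqueness from the final time shows that this z1 is
the given one.  The two formulas are then the integrals over [t0, T] of

  <z1, xh>' = eps <u, y>,
  <q1, z1>' = eps (<R^-1 u, u> + <Q^-1 z, z>) + |q|^2;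

in the second one the boundary term at t0 is the middle term of Omega.

Three facts support this computation.

The solutions are absolutely continuous and satisfy their equations almost
everywhere only, so everything rests on abs_continuous_le: an absolutely
continuous function whose derivative is nonnegative almost everywhere does not
decrease.  It yields uniqueness for linear equations through Gronwall's
inequality (linear_ode_eq0), and, applied to the difference with an indefinite
integral, it yields the integral of a derivative (ode_integral).

The matrix I + K(T) is invertible because K(T) is symmetric and nonnegative
(riccati_sym, riccati_nonneg).  With A = Ceps + Qeps K the Riccati equation
reads K' = - K A - A^T K + N, where N = K Qeps K + Seps is nonnegative.  To
first order, a time step h replaces K by (I - h A)^T K (I - h A) + h N, and a
congruence preserves nonnegativity (riccati_psd).  Nonnegativity of Qeps and
Seps holds because they are built from Schur complements of nonnegative
matrices (possemidef_schur).

The weighted norms in Omega are quadratic forms, because a nonnegative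
symmetric matrix has a square root (possemidef_sqrt). *)

(** * Monotonicity of absolutely continuous functions *)

(** A form of the compactness of [a, b] (Cousin's lemma): the supremum of the
points t with J a t can be neither below b nor unattained, as J holds on all
small intervals around that supremum. *)
Lemma interval_induction (R : realType) (a b : R) (J : R -> R -> Prop) :
  a <= b ->
  (forall s m t, a <= s -> s <= m -> m <= t -> t <= b ->
    J s m -> J m t -> J s t) ->
  (forall x, a <= x -> x <= b -> exists2 d : R, 0 < d &
    forall s t, a <= s -> s <= x -> x <= t -> t <= b ->
      x - d < s -> t < x + d -> J s t) ->
  J a b.
Proof.
move=> ab Jtr Jloc.
pose E := [set t | a <= t /\ t <= b /\ J a t].
have Ea : E a.
  have [d d0 Jd] := Jloc a (lexx _) ab.
  by split=> //; split=> //; apply: Jd; rewrite ?ltrBlDr ?ltrDl.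
have hsE : has_sup E.
  by split; [exists a | exists b => t [_ []]].
set c := sup E.
have ac : a <= c by apply: sup_upper_bound.
have cb : c <= b by apply: ge_sup; [exists a | move=> t [_ []]].
have [d d0 Jd] := Jloc c ac cb.
have [e [ae [eb Je]] ce] := sup_adherent d0 hsE.
have ec : e <= c by apply: sup_upper_bound.
have Jac : J a c.
  apply: (Jtr a e c) => //; apply: Jd => //.
  by rewrite ltrDl.
have [cb'|cltb] := eqVneq c b; first by rewrite -cb'.
have {}cltb : c < b by rewrite lt_neqAle cltb.
pose t := Num.min b (c + d / 2).
have ct : c < t by rewrite /t lt_min cltb ltrDl divr_gt0.
have : E t.
  split; first exact: le_trans ac (ltW ct).
  have tb : t <= b by rewrite /t ge_min lexx.
  split=> //.
  apply: (Jtr a c t) => //; first exact: ltW.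
  apply: Jd => //; first exact: ltW.
    by rewrite ltrBlDr ltrDl.
  have : t <= c + d / 2 by rewrite /t ge_min lexx orbT.
  by lra.
move=> /(sup_upper_bound hsE) tc; have : t <= c := tc.
by rewrite leNgt ct.
Qed.

Section monotone.
Context {R : realType}.
Local Notation mu := (@lebesgue_measure R).

Fixpoint ordered_in (s t : R) (L : seq (R * R)) : Prop :=
  if L is A :: L' then s <= A.1 /\ A.1 <= A.2 /\ ordered_in A.2 t L' else s <= t.

Lemma ordered_in_le s t L : ordered_in s t L -> s <= t.
Proof.
elim: L s => //= A L IH s [sI [I12 /IH]].
by move=> I2t; apply: le_trans sI _; apply: le_trans I12 _.
Qed.

Lemma ordered_in_cat s m t L1 L2 :
  ordered_in s m L1 -> ordered_in m t L2 -> ordered_in s t (L1 ++ L2).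
Proof.
elim: L1 s => [|A L1 IH] s /= => [sm|[sI [I12 h1]] h2]; last first.
  by split=> //; split=> //; exact: IH.
by case: L2 => [|A L2] /= => [/(le_trans sm)//|[/(le_trans sm) ? ?]].
Qed.

Lemma ordered_in_nth s t L i : ordered_in s t L -> (i < size L)%N ->
  let A := nth (0, 0) L i in [/\ s <= A.1, A.1 <= A.2 & A.2 <= t].
Proof.
elim: L s i => //= A L IH s [|i] [sI [I12 h]] /=; rewrite ?ltnS => iL.
  by split=> //; exact: ordered_in_le h.
have [h1 h2 h3] := IH _ _ h iL; split=> //.
by apply: le_trans sI _; apply: le_trans I12 _.
Qed.

Lemma ordered_in_nth_lt s t L i j : ordered_in s t L ->
  (i < j)%N -> (j < size L)%N -> (nth (0, 0) L i).2 <= (nth (0, 0) L j).1.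
Proof.
elim: L s i j => //= A L IH s [|i] [|j] [sI [I12 h]] //=; rewrite ?ltnS => ij jL.
  by have [] := ordered_in_nth h jL.
exact: IH h ij jL.
Qed.

(** Turns a list of consecutive intervals into the disjoint family, indexed by
an ordinal, over which absolute continuity quantifies. *)
Lemma abs_continuous_ordered (a b : R) (f : R -> R) (e d : R) L :
  (forall (N : nat) (s t : 'I_N -> R),
      (forall i, [/\ a <= s i, s i <= t i & t i <= b]) ->
      trivIset setT (fun i => `]s i, t i[%classic) ->
      \sum_(i < N) (t i - s i) < d ->
      \sum_(i < N) `|f (t i) - f (s i)| < e) ->
  ordered_in a b L -> \sum_(A <- L) (A.2 - A.1) < d ->
  \sum_(A <- L) `|f A.2 - f A.1| < e.
Proof.
move=> h oL; rewrite !(big_nth (0, 0)) !big_mkord => Ld.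
apply: (h _ (fun i => (nth (0, 0) L i).1) (fun i => (nth (0, 0) L i).2)) => //.
  by move=> i; apply: ordered_in_nth.
have disj (i j : 'I_(size L)) x : (i < j)%N ->
    `](nth (0, 0) L i).1, (nth (0, 0) L i).2[%classic x ->
    `](nth (0, 0) L j).1, (nth (0, 0) L j).2[%classic x -> False.
  move=> ij; rewrite /= !in_itv/= => /andP[_ h1] /andP[h2 _].
  have := ordered_in_nth_lt oL ij (ltn_ord j).
  by rewrite leNgt (lt_trans h2 h1).
move=> i j _ _ [x [xi xj]]; apply/val_inj => /=.
case: (ltngtP i j) => // ij; exfalso.
  exact: disj ij xi xj.
exact: disj ij xj xi.
Qed.

Lemma is_derive_near (f : R -> R) (t g e : R) : is_derive t 1 f g -> 0 < e ->
  exists2 d : R, 0 < d & forall s, `|s - t| < d ->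
    `|f s - f t - g * (s - t)| <= e * `|s - t|.
Proof.
move=> [df <-] e0; move: df => /cvg_ex[l hl].
have -> : 'D_1 f t = l by apply/cvg_lim.
move/cvgrPdist_le: hl => /(_ e e0)[d /= d0 hd].
exists d => // s st.
have [->|snet] := eqVneq s t; first by rewrite !subrr mulr0 subrr normr0 mulr0.
have := hd (s - t).
rewrite /ball_ /= sub0r normrN => /(_ st); rewrite subr_eq0 => /(_ snet).
rewrite /= [_ *: 1]mulr1 subrK => h.
have st0 : s - t != 0 by rewrite subr_eq0.
have -> : f s - f t - l * (s - t)
   = - (l - (s - t)^-1 * (f s - f t)) * (s - t) by field.
by rewrite normrM normrN ler_wpM2r.
Qed.

(** Up to e, the increments of f are nonnegative on small intervals around the
points where f has a nonnegative derivative.  The remaining points form a null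
set, which lies in an open set U of measure less than d; the intervals of a
partition that surround them are inside U, so absolute continuity makes the sum
of the corresponding increments smaller than e.  Interval induction provides
the partition; the intervals inside U are recorded in a list L. *)
Lemma abs_continuous_le (a b : R) (f : R -> R) : a <= b ->
  abs_continuous a b f ->
  {ae mu, forall t, t \in `[a, b] -> exists2 g : R, 0 <= g & is_derive t 1 f g} ->
  f a <= f b.
Proof.
move=> ab fac [N [mN N0 hN]].
suff H (e : R) : 0 < e -> f a - e * (b - a + 1) <= f b.
  apply/ler_addgt0Pl => e e0.
  have ba : 0 < b - a + 1 by rewrite ltr_wpDl// subr_ge0.
  have := H (e / (b - a + 1)) (divr_gt0 e0 ba).
  by rewrite divfK ?gt_eqF// lerBlDl.
move=> e0; have [d d0 hd] := fac e e0.
have N0oo : (mu N < +oo)%E by rewrite N0.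
have [U [oU NU Ud]] := lebesgue_regularity_outer mN N0oo d0.
have mU : measurable U by exact: open_measurable.
have {}Ud : (mu U < d%:E)%E.
  rewrite -(setDUK NU) measureU//=; first by rewrite N0 add0e.
    exact: measurableD.
  by rewrite setDE setIC -setIA setICl setI0.
pose h (s : R) := fine (mu (U `&` `]a, s])).
have Ufin A : measurable A -> mu (U `&` A) \is a fin_num.
  move=> mA; rewrite ge0_fin_numE//.
  apply: (@le_lt_trans _ _ (mu U)); last exact: lt_trans Ud (ltry _).
  by apply: le_measure; rewrite ?inE//; exact: measurableI.
have hD s t : a <= s -> s <= t -> h t = h s + fine (mu (U `&` `]s, t])).
  move=> as_ st; rewrite /h -fineD ?Ufin// -measureU//.
  - rewrite -setIUr; congr (fine (mu (_ `&` _))).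
    by rewrite -(@itv_bndbnd_setU _ _ (BRight a) (BRight s) (BRight t)).
  - exact: measurableI.
  - exact: measurableI.
  - apply/seteqP; split=> // x [[_ xas] [_ xst]].
    move: xas xst; rewrite /= !in_itv/= => /andP[_ xs] /andP[sx _].
    by move: sx; rewrite ltNge xs.
have hle s t : a <= s -> s <= t -> h s <= h t.
  by move=> as_ st; rewrite (hD s t)// lerDl fine_ge0.
have hU s t : a <= s -> s <= t -> `]s, t]%classic `<=` U -> t - s <= h t - h s.
  move=> as_ st sU; rewrite (hD s t)// [leRHS]addrC addKr.
  by rewrite (setIidr sU) lebesgue_measure_itv/= lte_fin;
    case: ltP => // ts; rewrite subr_le0.
have hd' : h b - h a < d.
  rewrite (hD a b)// addrC addKr -lte_fin fineK ?Ufin//.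
  by apply: le_lt_trans Ud; apply: le_measure; rewrite ?inE//; exact: measurableI.
(* The second condition bounds the total length of L by the measure of
   U between s and t, which is additive, unlike the measure of U as a whole. *)
pose J s t := exists L, [/\ ordered_in s t L,
  \sum_(A <- L) (A.2 - A.1) <= h t - h s &
  f s - e * (t - s) - \sum_(A <- L) `|f A.2 - f A.1| <= f t].
have [L [oL hL fL]] : J a b.
  apply: interval_induction => // [s m t as_ sm mt tb|x ax xb].
    move=> [L1 [k1 h1 f1]] [L2 [k2 h2 f2]].
    exists (L1 ++ L2); split.
    - exact: ordered_in_cat k1 k2.
    - by rewrite big_cat/=; lra.
    - by rewrite big_cat/=; lra.
  have [xN|xN] := pselect (N x).
    have [r /= r0 rU] : nbhs x U by apply: open_nbhs_nbhs; split=> //; exact: NU.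
    exists r => // s t as_ sx xt tb rs tr.
    exists [:: (s, t)]; split => /=; first by rewrite lexx (le_trans sx xt).
    - rewrite big_seq1/=; apply: hU => //; first exact: le_trans sx xt.
      move=> z /=; rewrite in_itv/= => /andP[sz zt]; apply: rU.
      by rewrite /ball /= ltr_norml; apply/andP; split; lra.
    - rewrite big_seq1/=.
      have := ler_norm (f s - f t); rewrite distrC => le1.
      have : 0 <= e * (t - s).
        by apply: mulr_ge0; [exact: ltW | rewrite subr_ge0 (le_trans sx xt)].
      by lra.
  have [g g0 fg] : exists2 g : R, 0 <= g & is_derive x 1 f g.
    apply: contrapT => nx; apply: xN; apply: hN => /= H; apply: nx; apply: H.
    by rewrite in_itv/= ax xb.
  have [r r0 hr] := is_derive_near fg e0.
  exists r => // s t as_ sx xt tb rs tr.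
  exists [::]; split => /=; first exact: le_trans sx xt.
    rewrite big_nil subr_ge0; apply: hle => //; exact: le_trans sx xt.
  rewrite big_nil subr0.
  have rs' : `|s - x| < r by rewrite ltr_norml; apply/andP; split; lra.
  have rt' : `|t - x| < r by rewrite ltr_norml; apply/andP; split; lra.
  have /ler_normlP[h1 _] := hr _ rt'.
  have /ler_normlP[_ h2] := hr _ rs'.
  have gt : 0 <= g * (t - x) by rewrite mulr_ge0// subr_ge0.
  have gs : 0 <= g * (x - s) by rewrite mulr_ge0// subr_ge0.
  rewrite ger0_norm ?subr_ge0// in h1.
  rewrite ler0_norm ?subr_le0// in h2.
  by lra.
have := abs_continuous_ordered hd oL (le_lt_trans hL hd').
by lra.
Qed.

End monotone.

(** * Calculus of absolutely continuous solutions *)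

Section almost_everywhere.
Context {R : realType}.
Local Notation mu := (@lebesgue_measure R).
Implicit Types P Q S : R -> Prop.

Lemma ae_imply P Q : (forall t, P t -> Q t) ->
  {ae mu, forall t, P t} -> {ae mu, forall t, Q t}.
Proof. exact: (@filterS _ _ (ae_filter_ringOfSetsType mu)). Qed.

Lemma ae_imply2 P Q S : (forall t, P t -> Q t -> S t) ->
  {ae mu, forall t, P t} -> {ae mu, forall t, Q t} -> {ae mu, forall t, S t}.
Proof. exact: (@filterS2 _ _ (ae_filter_ringOfSetsType mu)). Qed.

Lemma ae_forall (I : finType) (P : I -> R -> Prop) :
  (forall i, {ae mu, forall t, P i t}) -> {ae mu, forall t, forall i, P i t}.
Proof. exact: (@filter_forall _ _ _ _ (ae_filter_ringOfSetsType mu)). Qed.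

Lemma ae_true P : (forall t, P t) -> {ae mu, forall t, P t}.
Proof. by move=> hP; exact: aeW. Qed.

End almost_everywhere.

Section ode_rules.
Context {R : realType} (a b : R).
Local Notation mu := (@lebesgue_measure R).
Local Notation ode := (ode_solution a b).
Local Notation cont f := {within `[a, b], continuous f}.

Lemma ode_ext (V : normedModType R) (f g h : R -> V) : ode f g ->
  {ae mu, forall t, t \in `[a, b] -> g t = h t} -> ode f h.
Proof.
move=> [fac fg] gh; split=> //; apply: ae_imply2 fg gh => t fg gh tab.
by rewrite -gh//; exact: fg.
Qed.

Lemma ode_subitv (V : normedModType R) (f g : R -> V) (s t : R) :
  ode f g -> a <= s -> t <= b -> ode_solution s t f g.
Proof.
move=> [fac fg] as_ tb; split.
  move=> e e0; have [d d0 hd] := fac e e0; exists d => // N x y xy.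
  apply: hd => i; have [h1 h2 h3] := xy i; split=> //; first exact: le_trans h1.
  exact: le_trans h3 tb.
apply: ae_imply fg => x h; rewrite in_itv/= => /andP[sx xt]; apply: h.
by rewrite in_itv/= (le_trans as_ sx) (le_trans xt tb).
Qed.

Lemma abs_continuous_mxP m n (X : R -> 'M[R]_(m, n)) :
  abs_continuous a b X <-> forall i j, abs_continuous a b (fun t => X t i j).
Proof.
have nX (i : 'I_m) (j : 'I_n) (M : 'M[R]_(m, n)) : `|M i j| <= `|M|.
  by rewrite [leRHS]/Num.Def.normr/= mx_normrE (le_bigmax _ _ (i, j)).
split=> [h i j e e0|h e e0].
  have [d d0 hd] := h e e0; exists d => // N s t st tr Nd.
  apply: le_lt_trans (hd N s t st tr Nd); apply: ler_sum => k _.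
  by rewrite (le_trans _ (nX i j _))// !mxE.
(* One more than the number of entries, so that empty matrices need no
   separate case. *)
pose k := (m * n).+1%:R : R.
have k0 : 0 < k by rewrite ltr0n.
have /choice[d hd] : forall ij : 'I_m * 'I_n, exists d : R, 0 < d /\
    forall (N : nat) (s t : 'I_N -> R),
      (forall i, [/\ a <= s i, s i <= t i & t i <= b]) ->
      trivIset setT (fun i => `]s i, t i[%classic) ->
      \sum_(i < N) (t i - s i) < d ->
      \sum_(i < N) `|X (t i) ij.1 ij.2 - X (s i) ij.1 ij.2| < e / k.
  move=> [i j]; have [d d0 hd] := h i j (e / k) (divr_gt0 e0 k0).
  by exists d.
pose D := \big[Num.min/1]_ij d ij.
exists D; first by apply: lt_bigmin => // ij _; exact: (hd ij).1.
move=> N s t st tr ND.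
apply: (@le_lt_trans _ _ (\sum_ij \sum_(l < N)
   `|X (t l) ij.1 ij.2 - X (s l) ij.1 ij.2|)).
  rewrite exchange_big/=; apply: ler_sum => l _.
  rewrite [leLHS]/Num.Def.normr/= mx_normrE; apply: bigmax_le => [|ij _].
    by apply: sumr_ge0.
  by rewrite (bigD1 ij)//= !mxE lerDl sumr_ge0.
apply: (@le_lt_trans _ _ (\sum_(ij : 'I_m * 'I_n) e / k)).
  apply: ler_sum => ij _; apply/ltW/(hd ij).2 => //.
  by apply: lt_le_trans ND _; exact: bigmin_le.
rewrite sumr_const card_prod !card_ord -[_ *+ _]mulr_natr.
by rewrite mulrAC ltr_pdivrMr// ltr_pM2l// ltr_nat.
Qed.

Lemma is_derive_mxP m n (X : R -> 'M[R]_(m, n)) (G : 'M[R]_(m, n)) (t : R) :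
  is_derive t 1 X G <-> forall i j, is_derive t 1 (fun t => X t i j) (G i j).
Proof.
split=> [[dX <-] i j|h].
  split; first by move/derivable_mxP: dX; exact.
  by rewrite derive_mx// mxE.
have dX : derivable X t 1 by apply/derivable_mxP => i j; have [] := h i j.
split=> //; rewrite derive_mx//; apply/matrixP => i j; rewrite mxE.
by have [_ ->] := h i j.
Qed.

Lemma ode_mxP m n (X G : R -> 'M[R]_(m, n)) :
  ode X G <-> forall i j, ode (fun t => X t i j) (fun t => G t i j).
Proof.
split=> [[/abs_continuous_mxP Xac XG] i j|h].
  split=> //; by apply: ae_imply XG => t h /h /is_derive_mxP.
split; first by apply/abs_continuous_mxP => i j; have [] := h i j.
have : {ae mu, forall t, forall ij : 'I_m * 'I_n,  t \in `[a, b] ->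
    is_derive t 1 (fun t => X t ij.1 ij.2) (G t ij.1 ij.2)}.
  by apply: ae_forall => ij; have [] := h ij.1 ij.2.
by apply: ae_imply => t ht tab; apply/is_derive_mxP => i j; exact: (ht (i, j)).
Qed.

Lemma abs_continuous_cont (f : R -> R) : abs_continuous a b f -> cont f.
Proof.
move=> fac; apply/subspace_continuousP => x /= xab.
apply/cvgrPdist_lt => e e0.
have [d d0 hd] := fac e e0.
have key s t : a <= s -> s <= t -> t <= b -> t - s < d -> `|f t - f s| < e.
  move=> as_ st tb tsd.
  have := hd 1 (fun=> s) (fun=> t); rewrite !big_ord1; apply=> //.
  by move=> i j _ _ _; rewrite (ord1 i) (ord1 j).
rewrite near_withinE; near=> y => /= yab.
have xy : `|x - y| < d by near: y; exact: cvgr_dist_lt.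
move: xab yab; rewrite !in_itv/= => /andP[ax xb] /andP[ay yb].
have [h|/ltW h] := leP y x; [|rewrite distrC]; apply: key => //.
  by apply: le_lt_trans xy; rewrite ler_norm.
by apply: le_lt_trans xy; rewrite distrC ler_norm.
Unshelve. all: by end_near. Qed.

Lemma cont_bounded (f : R -> R) : cont f ->
  exists2 c : R, 0 < c & forall t, t \in `[a, b] -> `|f t| <= c.
Proof.
move=> fc; have [ab|ba] := leP a b; last first.
  exists 1 => // t; rewrite in_itv/= => /andP[h1 h2].
  by have := le_lt_trans (le_trans h1 h2) ba; rewrite ltxx.
have [c cab hc] := EVT_max ab fc.
have [d dab hd] := EVT_min ab fc.
exists (1 + `|f c| + `|f d|) => [|t tab].
  by rewrite ltr_wpDr// ltr_wpDr.
have h1 := hc t tab; have h2 := hd t tab.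
rewrite ler_norml; have := ler_norm (f c); have := ler_norm (- f d).
have := normr_ge0 (f c); have := normr_ge0 (f d).
by rewrite normrN => *; apply/andP; split; lra.
Qed.

Lemma abs_continuous_bounded (f : R -> R) : abs_continuous a b f ->
  exists2 c : R, 0 < c & forall t, t \in `[a, b] -> `|f t| <= c.
Proof. by move=> /abs_continuous_cont/cont_bounded. Qed.

Lemma ode_cst (V : normedModType R) (c : V) : ode (cst c) (cst 0).
Proof.
split.
  by move=> e e0; exists 1 => // N s t _ _ _; rewrite big1// => i _; rewrite subrr normr0.
by apply: ae_true => /= t _; exact: is_derive_cst.
Qed.

Lemma odeD (f g f' g' : R -> R) : ode f g -> ode f' g' ->
  ode (fun t => f t + f' t) (fun t => g t + g' t).
Proof.
move=> [fac fg] [fac' fg']; split; last first.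
  by apply: ae_imply2 fg fg' => t + + tab => /(_ tab) h1 /(_ tab) h2; exact: is_deriveD.
move=> e e0; have e20 : 0 < e / 2 by rewrite divr_gt0.
have [d d0 hd] := fac _ e20; have [d' d'0 hd'] := fac' _ e20.
exists (Num.min d d'); first by rewrite lt_min d0.
move=> N s t st tr; rewrite lt_min => /andP[Nd Nd'].
apply: (@le_lt_trans _ _ (\sum_(i < N) (`|f (t i) - f (s i)|
     + `|f' (t i) - f' (s i)|))).
  apply: ler_sum => i _; apply: le_trans (ler_normD _ _).
  by rewrite addrACA opprD.
by rewrite big_split/= [ltRHS]splitr ltrD// ?hd// hd'.
Qed.

Lemma odeM (f g f' g' : R -> R) : ode f g -> ode f' g' ->
  ode (fun t => f t * f' t) (fun t => g t * f' t + f t * g' t).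
Proof.
move=> [fac fg] [fac' fg']; split; last first.
  apply: ae_imply2 fg fg' => t + + tab => /(_ tab) h1 /(_ tab) h2.
  have -> : g t * f' t + f t * g' t = f t *: g' t + f' t *: g t.
    by rewrite addrC [g t * _]mulrC.
  exact: is_deriveM.
have [c c0 hc] := abs_continuous_bounded fac.
have [c' c'0 hc'] := abs_continuous_bounded fac'.
move=> e e0.
have e1 : 0 < e / 2 / c' by rewrite !divr_gt0.
have e1' : 0 < e / 2 / c by rewrite !divr_gt0.
have [d d0 hd] := fac _ e1; have [d' d'0 hd'] := fac' _ e1'.
exists (Num.min d d'); first by rewrite lt_min d0.
move=> N s t st tr; rewrite lt_min => /andP[Nd Nd'].
apply: (@le_lt_trans _ _ (\sum_(i < N) (`|f (t i) - f (s i)| * c'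
     + c * `|f' (t i) - f' (s i)|))).
  apply: ler_sum => i _; have [as_ st' tb] := st i.
  have -> : f (t i) * f' (t i) - f (s i) * f' (s i)
    = (f (t i) - f (s i)) * f' (t i) + f (s i) * (f' (t i) - f' (s i)) by ring.
  apply: le_trans (ler_normD _ _) _; rewrite !normrM.
  apply: lerD; [apply: ler_wpM2l => //; apply: hc'|apply: ler_wpM2r => //; apply: hc].
    by rewrite in_itv/= tb (le_trans as_).
  by rewrite in_itv/= as_ (le_trans st').
rewrite big_split/= -mulr_suml -mulr_sumr [ltRHS]splitr ltrD//.
  by rewrite -ltr_pdivlMr// hd.
by rewrite mulrC -ltr_pdivlMr// hd'.
Qed.

Lemma odeN (f g : R -> R) : ode f g -> ode (fun t => - f t) (fun t => - g t).
Proof.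
move=> [fac fg]; split.
  move=> e /fac[d d0 hd]; exists d => // N s t st tr Nd.
  apply: le_lt_trans (hd N s t st tr Nd).
  by apply: ler_sum => i _; rewrite -opprD normrN.
by apply: ae_imply fg => t h /h; exact: is_deriveN.
Qed.

Lemma odeB (f g f' g' : R -> R) : ode f g -> ode f' g' ->
  ode (fun t => f t - f' t) (fun t => g t - g' t).
Proof. by move=> fg fg'; apply: odeD => //; exact: odeN. Qed.

Lemma ode_sum (I : Type) (L : seq I) (f g : I -> R -> R) :
  (forall i, ode (f i) (g i)) ->
  ode (fun t => \sum_(i <- L) f i t) (fun t => \sum_(i <- L) g i t).
Proof.
move=> fg; elim: L => [|i L IH].
  under eq_fun do rewrite big_nil; under [X in _ _ X]eq_fun do rewrite big_nil.
  exact: ode_cst.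
under eq_fun do rewrite big_cons; under [X in _ _ X]eq_fun do rewrite big_cons.
exact: odeD.
Qed.

Lemma ode_addmx m n (X G Y H : R -> 'M[R]_(m, n)) : ode X G -> ode Y H ->
  ode (fun t => X t + Y t) (fun t => G t + H t).
Proof.
move=> /ode_mxP XG /ode_mxP YH; apply/ode_mxP => i j.
under eq_fun do rewrite mxE; under [X in _ _ X]eq_fun do rewrite mxE.
exact: odeD.
Qed.

Lemma ode_mulmx m n p (X G : R -> 'M[R]_(m, n)) (Y H : R -> 'M[R]_(n, p)) :
  ode X G -> ode Y H ->
  ode (fun t => X t *m Y t) (fun t => G t *m Y t + X t *m H t).
Proof.
move=> /ode_mxP XG /ode_mxP YH; apply/ode_mxP => i j.
under eq_fun do rewrite mxE; under [X in _ _ X]eq_fun do rewrite !mxE -big_split/=.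
by apply: ode_sum => k; exact: odeM.
Qed.

Lemma ode_cstmul m n p (c : 'M[R]_(p, m)) (X G : R -> 'M[R]_(m, n)) : ode X G ->
  ode (fun t => c *m X t) (fun t => c *m G t).
Proof.
move=> XG; apply: ode_ext (ode_mulmx (ode_cst c) XG) _.
by apply: ae_true => /= t _; rewrite mul0mx add0r.
Qed.

Lemma ode_trmx m n (X G : R -> 'M[R]_(m, n)) : ode X G ->
  ode (fun t => (X t)^T) (fun t => (G t)^T).
Proof.
move=> /ode_mxP XG; apply/ode_mxP => i j.
by under eq_fun do rewrite mxE; under [X in _ _ X]eq_fun do rewrite mxE.
Qed.

Lemma ode_oppmx m n (X G : R -> 'M[R]_(m, n)) : ode X G ->
  ode (fun t => - X t) (fun t => - G t).
Proof.
move=> /ode_mxP XG; apply/ode_mxP => i j.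
under eq_fun do rewrite mxE; under [X in _ _ X]eq_fun do rewrite mxE.
exact: odeN.
Qed.

Lemma ode_le (f g : R -> R) : ode f g ->
  {ae mu, forall t, t \in `[a, b] -> 0 <= g t} ->
  forall s t, a <= s -> s <= t -> t <= b -> f s <= f t.
Proof.
move=> fg g0 s t as_ st tb.
have [fac fg'] := ode_subitv fg as_ tb.
apply: abs_continuous_le => //; apply: ae_imply2 fg' g0 => x h1 h2 xst.
exists (g x); last exact: h1.
apply: h2; move: xst; rewrite !in_itv/= => /andP[sx xt].
by rewrite (le_trans as_ sx) (le_trans xt tb).
Qed.

End ode_rules.

(** * Integral of an almost everywhere derivative *)

Section primitive.
Context {R : realType} (g : R -> R).
Local Notation mu := (@lebesgue_measure R).
Hypothesis gint : mu.-integrable setT (EFin \o g).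

Let G y := \int[mu]_(t in `]-oo, y]) g t.

Let gintS A : measurable A -> mu.-integrable A (EFin \o g).
Proof. by move=> mA; apply: integrableS gint. Qed.

Let GB s t : s <= t -> G t - G s = \int[mu]_(x in `]s, t[) g x.
Proof.
move=> st; rewrite /G Rintegral_itvB ?bnd_simp//; last exact: gintS.
by rewrite -Rintegral_itv_bndo_bndc//; exact: gintS.
Qed.

(** Absolute continuity of the integral: a finite union of disjoint intervals is
a set of small measure, over which |g| has a small integral. *)
Lemma abs_continuous_primitive a b : abs_continuous a b G.
Proof.
move=> e e0; have [d [d0 hd]] := integral_normr_continuous gint e0.
exists d => // N s t st tr Nd.
pose D := \big[setU/set0]_(i < N) `]s i, t i[%classic.
have mD : measurable D by apply: bigsetU_measurable.
have muD : (mu D < d%:E)%E.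
  rewrite /D measure_bigsetU_ord//.
  rewrite (eq_bigr (fun i => (t i - s i)%:E)) => [|i _].
    by rewrite sumEFin lte_fin.
  have [_ h _] := st i; rewrite /= lebesgue_measure_itv/= lte_fin.
  by move: h; rewrite le_eqVlt => /orP[/eqP ->|->//]; rewrite ltxx subrr.
apply: le_lt_trans (hd D mD muD).
have gn A : measurable A -> mu.-integrable A (fun x => `|g x|%:E).
  by move=> mA; exact: (integrable_norm (gintS mA)).
have -> : \int[mu]_(x in D) `|g x| =
    \sum_(i < N) \int[mu]_(x in `]s i, t i[) `|g x|.
  rewrite /Rintegral integral_bigsetU_EFin//=.
  - by rewrite -sum_fine// => i _; apply: integrable_fin_num => //; exact: gn.
  - exact: index_enum_uniq.
  - exact: sub_trivIset tr.
  - exact: (measurable_int mu (gn _ mD)).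
apply: ler_sum => i _; have [_ h _] := st i.
by rewrite GB//; apply: le_normr_Rintegral => //; exact: gintS.
Qed.

(** Lebesgue's differentiation theorem supplies the derivative. *)
Lemma ode_primitive a b : ode_solution a b G g.
Proof.
split; first exact: abs_continuous_primitive.
have locg : locally_integrable setT g.
  by apply: open_integrable_locally => //; exact: openT.
have := @FTC1Ny R g (fun y => gintS (measurable_itv _)) locg.
apply: ae_imply => t [h1 h2] _; apply: (DeriveDef h1).
by rewrite -derive1E; exact: h2.
Qed.

End primitive.

Section integral_of_derivative.
Context {R : realType} (a b : R).
Local Notation mu := (@lebesgue_measure R).
Local Notation ode := (ode_solution a b).

(** The difference of f and of an indefinite integral of g has derivative zero
almost everywhere, so it is constant by monotonicity applied in both
directions. *)
Lemma ode_integral (f g : R -> R) : a <= b -> ode f g ->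
  mu.-integrable `[a, b] (EFin \o g) ->
  \int[mu]_(t in `[a, b]) g t = f b - f a.
Proof.
move=> ab fg gint.
pose h := g \_ `[a, b].
have hint : mu.-integrable setT (EFin \o h).
  rewrite /h -restrict_EFin; apply: (iffLR (integrable_mkcond _ _)) => //.
pose G (y : R) : R := \int[mu]_(t in `]-oo, y]) h t.
have Gh : ode G h := ode_primitive hint a b.
have hg t : t \in `[a, b] -> h t = g t.
  by move=> tab; rewrite /h patchE ifT// inE.
have le1 (f1 g1 f2 g2 : R -> R) : ode f1 g1 -> ode f2 g2 ->
    {ae mu, forall t, t \in `[a, b] -> g1 t = g2 t} ->
    f1 a - f2 a <= f1 b - f2 b.
  move=> h1 h2 h12; apply: (ode_le (odeB h1 h2)) => //.
  by apply: ae_imply h12 => t e /e ->; rewrite subrr.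
have : G b - G a = f b - f a.
  have e1 : {ae mu, forall t, t \in `[a, b] -> h t = g t} by exact: ae_true.
  have e2 : {ae mu, forall t, t \in `[a, b] -> g t = h t}.
    by apply: ae_true => t /hg.
  have h1 : G a - f a <= G b - f b := le1 _ _ _ _ Gh fg e1.
  have h2 : f a - G a <= f b - G b := le1 _ _ _ _ fg Gh e2.
  by lra.
move=> <-; rewrite /G Rintegral_itvB ?bnd_simp//; last exact: integrableS hint.
rewrite Rintegral_itv_obnd_cbnd; last exact: integrableS hint.
by apply: eq_Rintegral => x; rewrite inE => /hg.
Qed.

End integral_of_derivative.

(** * Uniqueness for linear equations *)

Section linear_uniqueness.
Context {R : realType} (a b : R).
Local Notation mu := (@lebesgue_measure R).
Local Notation ode := (ode_solution a b).

Lemma ode_bounded_derivative (f g : R -> R) (c : R) :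
  (forall t : R, is_derive t 1 f (g t)) ->
  (forall t, t \in `[a, b] -> `|g t| <= c) -> ode f g.
Proof.
move=> fg gc; split; last by apply: ae_true => t _.
have c0 : 0 < `|c| + 1 by rewrite ltr_wpDl.
move=> e e0; exists (e / (`|c| + 1)); first by rewrite divr_gt0.
move=> N s t st _ Nd.
apply: (@le_lt_trans _ _ (\sum_(i < N) (t i - s i) * (`|c| + 1))); last first.
  by rewrite -mulr_suml -ltr_pdivlMr.
apply: ler_sum => i _; have [as_ sti tb] := st i.
have fc : {within `[s i, t i], continuous f}.
  apply: derivable_within_continuous => x _.
  by have [] := fg x.
have [x xst ->] := MVT_segment sti (fun x _ => fg x) fc.
rewrite normrM mulrC ger0_norm ?subr_ge0// ler_wpM2l ?subr_ge0//.
have := gc x; move: xst; rewrite !in_itv/= => /andP[sx xt].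
rewrite (le_trans as_ sx) (le_trans xt tb) => /(_ isT) /le_trans; apply.
by rewrite (le_trans (ler_norm _))// lerDl.
Qed.

Lemma ode_expR (L : R) : ode (fun t => expR (L * t)) (fun t => L * expR (L * t)).
Proof.
have d (t : R) : is_derive t 1 (fun t => expR (L * t)) (L * expR (L * t)).
  have := is_derive1_comp (is_derive_expR (L * t)) (is_deriveZ L (is_derive_id t 1)).
  by rewrite /GRing.scale/= mulr1 mulrC.
apply: (@ode_bounded_derivative _ _ (`|L| * expR (`|L| * (`|a| + `|b|)))) => //.
move=> t; rewrite in_itv/= => /andP[at_ tb].
rewrite normrM [`|expR _|]ger0_norm ?expR_ge0// ler_wpM2l// ler_expR.
rewrite (le_trans (ler_norm _))// normrM ler_wpM2l//.
rewrite ler_norml; have := ler_norm b; have := ler_norm (- a).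
rewrite normrN => h1 h2; have := normr_ge0 b; have := normr_ge0 a => h3 h4.
by apply/andP; split; lra.
Qed.

(** The functions exp(- L t) f and exp(L t) f are respectively nonincreasing and
nondecreasing, so a zero of f propagates to the right and to the left. *)
Lemma ode_gronwall_eq0 (f g : R -> R) (L c : R) : ode f g ->
  (forall t, t \in `[a, b] -> 0 <= f t) ->
  {ae mu, forall t, t \in `[a, b] -> `|g t| <= L * f t} ->
  c \in `[a, b] -> f c = 0 -> forall t, t \in `[a, b] -> f t = 0.
Proof.
move=> fg f0 gL; rewrite in_itv/= => /andP[ac cb] fc0 t tab.
have := tab; rewrite in_itv/= => /andP[at_ tb].
apply/eqP; rewrite eq_le f0// andbT.
have [ct|/ltW tc] := leP c t.
  have h := odeN (odeM (ode_expR (- L)) fg).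
  have := ode_le h _ ac ct tb.
  rewrite fc0 mulr0 oppr0 oppr_ge0 pmulr_rle0 ?expR_gt0//; apply.
  apply: ae_imply gL => s + sab => /(_ sab) /ler_normlP[_ gs].
  rewrite [X in 0 <= X](_ : _ = expR (- L * s) * (L * f s - g s)); last by ring.
  by apply: mulr_ge0; [exact: expR_ge0|lra].
have h := odeM (ode_expR L) fg.
have := ode_le h _ at_ tc cb.
rewrite fc0 mulr0 pmulr_rle0 ?expR_gt0//; apply.
apply: ae_imply gL => s + sab => /(_ sab) /ler_normlP[gs _].
rewrite [X in 0 <= X](_ : _ = expR (L * s) * (L * f s + g s)); last by ring.
by apply: mulr_ge0; [exact: expR_ge0|lra].
Qed.

Definition bounded_entries m n (A : R -> 'M[R]_(m, n)) :=
  exists2 c : R, 0 <= c & forall t, t \in `[a, b] -> forall i j, `|A t i j| <= c.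

(** Gronwall's inequality for the sum of the squares of the entries of X.  The
two-sided form A X + X B covers both vector equations (B = 0) and the equation
of K - K^T for a solution K of a Riccati equation. *)
Lemma linear_ode_eq0 m n (A : R -> 'M[R]_m) (B : R -> 'M[R]_n)
    (X : R -> 'M[R]_(m, n)) (c : R) :
  bounded_entries A -> bounded_entries B ->
  ode X (fun t => A t *m X t + X t *m B t) ->
  c \in `[a, b] -> X c = 0 -> forall t, t \in `[a, b] -> X t = 0.
Proof.
move=> [cA cA0 hA] [cB cB0 hB] /ode_mxP hX cab Xc0 t tab.
pose f t := \sum_i \sum_j X t i j * X t i j.
pose G t := A t *m X t + X t *m B t.
pose g t := \sum_i \sum_j (G t i j * X t i j + X t i j * G t i j).
have fg : ode f g.
  by apply: ode_sum => i; apply: ode_sum => j; apply: odeM; apply: hX.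
have f0 s : 0 <= f s.
  by apply: sumr_ge0 => i _; apply: sumr_ge0 => j _; rewrite -expr2 sqr_ge0.
have Xf s i j : X s i j * X s i j <= f s.
  rewrite /f (bigD1 i)//= (bigD1 j)//= -addrA lerDl addr_ge0//.
    by apply: sumr_ge0 => k _; rewrite -expr2 sqr_ge0.
  by apply: sumr_ge0 => k _; apply: sumr_ge0 => l _; rewrite -expr2 sqr_ge0.
have XXf s i j k l : `|X s i j| * `|X s k l| <= f s.
  have := Xf s i j; have := Xf s k l.
  rewrite -!expr2 -(real_normK (num_real (X s i j))) -(real_normK (num_real (X s k l))).
  by nra.
pose L := \sum_(i < m) \sum_(j < n) (m%:R * cA + n%:R * cB) *+ 2.
have gL s : s \in `[a, b] -> `|g s| <= L * f s.
  move=> sab; rewrite /L mulr_suml.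
  apply: le_trans (ler_norm_sum _ _ _) _; apply: ler_sum => i _.
  rewrite mulr_suml.
  apply: le_trans (ler_norm_sum _ _ _) _; apply: ler_sum => j _.
  rewrite mulrC -mulr2n normrMn mulrnAl ler_wMn2r//.
  rewrite normrM /G !mxE.
  have h1 : `|X s i j| * `|\sum_j0 A s i j0 * X s j0 j| <= m%:R * cA * f s.
    rewrite -normrM mulr_sumr -mulrA mulr_natl -[m in leRHS]card_ord -sumr_const.
    apply: le_trans (ler_norm_sum _ _ _) _; apply: ler_sum => k _.
    rewrite !normrM mulrCA; apply: ler_pM; rewrite ?mulr_ge0//; exact: hA.
  have h2 : `|X s i j| * `|\sum_j0 X s i j0 * B s j0 j| <= n%:R * cB * f s.
    rewrite -normrM mulr_sumr -mulrA mulr_natl -[n in leRHS]card_ord -sumr_const.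
    apply: le_trans (ler_norm_sum _ _ _) _; apply: ler_sum => k _.
    rewrite !normrM mulrA mulrC; apply: ler_pM; rewrite ?mulr_ge0//; exact: hB.
  rewrite mulrDl (le_trans _ (lerD h1 h2))// -mulrDr ler_wpM2l//.
  exact: ler_normD.
have fc : f c = 0.
  by rewrite /f Xc0; apply: big1 => i _; apply: big1 => j _; rewrite mxE mulr0.
have ft := ode_gronwall_eq0 fg (fun s _ => f0 s) (ae_true gL) cab fc tab.
apply/matrixP => i j; rewrite mxE; apply/eqP.
have := Xf t i j; rewrite ft -expr2 => h.
by rewrite -sqrf_eq0 eq_le h sqr_ge0.
Qed.

End linear_uniqueness.

(** * Continuity of matrix functions *)

Section continuity.
Context {R : realType} (a b : R).
Local Notation mu := (@lebesgue_measure R).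
Local Notation cont f := {within `[a, b], continuous f}.
Implicit Types f g : R -> R.

Lemma cont_eq f g : f =1 g -> cont f -> cont g.
Proof. by move=> /funext ->. Qed.

Lemma cont_cst (c : R) : cont (fun=> c).
Proof. by apply/subspace_continuousP => x _; exact: cvg_cst. Qed.

Lemma contD f g : cont f -> cont g -> cont (fun t => f t + g t).
Proof.
move=> /subspace_continuousP fc /subspace_continuousP gc.
by apply/subspace_continuousP => x xab; apply: cvgD; [exact: fc|exact: gc].
Qed.

Lemma contN f : cont f -> cont (fun t => - f t).
Proof.
move=> /subspace_continuousP fc.
by apply/subspace_continuousP => x xab; apply: cvgN; exact: fc.
Qed.

Lemma contM f g : cont f -> cont g -> cont (fun t => f t * g t).
Proof.
move=> /subspace_continuousP fc /subspace_continuousP gc.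
by apply/subspace_continuousP => x xab; apply: cvgM; [exact: fc|exact: gc].
Qed.

Lemma contV f : (forall t, t \in `[a, b] -> f t != 0) -> cont f ->
  cont (fun t => (f t)^-1).
Proof.
move=> f0 /subspace_continuousP fc.
by apply/subspace_continuousP => x xab; apply: cvgV; [exact: f0|exact: fc].
Qed.

Lemma cont_sum (I : Type) (L : seq I) (f : I -> R -> R) :
  (forall i, cont (f i)) -> cont (fun t => \sum_(i <- L) f i t).
Proof.
move=> fc; elim: L => [|i L IH].
  by apply: cont_eq (@cont_cst 0) => t; rewrite big_nil.
by apply: cont_eq (contD (fc i) IH) => t; rewrite big_cons.
Qed.

Lemma cont_prod (I : Type) (L : seq I) (f : I -> R -> R) :
  (forall i, cont (f i)) -> cont (fun t => \prod_(i <- L) f i t).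
Proof.
move=> fc; elim: L => [|i L IH].
  by apply: cont_eq (@cont_cst 1) => t; rewrite big_nil.
by apply: cont_eq (contM (fc i) IH) => t; rewrite big_cons.
Qed.

Definition mxcont m n (X : R -> 'M[R]_(m, n)) :=
  forall i j, cont (fun t => X t i j).

Lemma mxcontP m n (X : R -> 'M[R]_(m, n)) : cont X -> mxcont X.
Proof.
move=> /subspace_continuousP Xc i j; apply/subspace_continuousP => x xab.
apply: (@continuous_cvg _ _ _ (within `[a, b] (nbhs x)) _ X
  (fun M : 'M[R]_(m, n) => M i j)); last exact: Xc.
exact: coord_continuous.
Qed.

Lemma mxcont_cst m n (c : 'M[R]_(m, n)) : mxcont (fun=> c).
Proof. by move=> i j; exact: cont_cst. Qed.

Lemma mxcontD m n (X Y : R -> 'M[R]_(m, n)) : mxcont X -> mxcont Y ->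
  mxcont (fun t => X t + Y t).
Proof.
by move=> Xc Yc i j; apply: cont_eq (contD (Xc i j) (Yc i j)) => t; rewrite mxE.
Qed.

Lemma mxcontN m n (X : R -> 'M[R]_(m, n)) : mxcont X -> mxcont (fun t => - X t).
Proof. by move=> Xc i j; apply: cont_eq (contN (Xc i j)) => t; rewrite mxE. Qed.

Lemma mxcontZ m n (c : R -> R) (X : R -> 'M[R]_(m, n)) : cont c -> mxcont X ->
  mxcont (fun t => c t *: X t).
Proof. by move=> cc Xc i j; apply: cont_eq (contM cc (Xc i j)) => t; rewrite mxE. Qed.

Lemma mxcontM m n p (X : R -> 'M[R]_(m, n)) (Y : R -> 'M[R]_(n, p)) :
  mxcont X -> mxcont Y -> mxcont (fun t => X t *m Y t).
Proof.
move=> Xc Yc i j.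
have h : cont (fun t => \sum_k X t i k * Y t k j).
  by apply: cont_sum => k; exact: contM.
by apply: cont_eq h => t; rewrite mxE.
Qed.

Lemma mxcont_tr m n (X : R -> 'M[R]_(m, n)) : mxcont X -> mxcont (fun t => (X t)^T).
Proof. by move=> Xc i j; apply: cont_eq (Xc j i) => t; rewrite mxE. Qed.

Lemma cont_det n (X : R -> 'M[R]_n) : mxcont X -> cont (fun t => \det (X t)).
Proof.
move=> Xc; apply: cont_sum => s; apply: contM; first exact: cont_cst.
by apply: cont_prod => i; exact: Xc.
Qed.

(** By the cofactor formula the entries of the inverse are rational functions
of the entries; the inverse is that formula on [a, b] only. *)
Lemma mxcont_inv n (X : R -> 'M[R]_n) :
  (forall t, t \in `[a, b] -> X t \in unitmx) ->
  mxcont X -> mxcont (fun t => invmx (X t)).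
Proof.
move=> Xu Xc i j.
have h : cont (fun t => (\det (X t))^-1 * (\adj (X t)) i j).
  apply: contM; first by apply: contV; [move=> t /Xu; rewrite unitmxE unitfE
    | exact: cont_det].
  have Yc : mxcont (fun t => row' j (col' i (X t))).
    by move=> k l; apply: cont_eq (Xc _ _) => t; rewrite !mxE.
  apply: cont_eq (contM (@cont_cst ((-1) ^+ (j + i))) (cont_det Yc)) => t.
  by rewrite mxE.
apply/subspace_continuousP => x xab.
have e t : t \in `[a, b] -> (\det (X t))^-1 * (\adj (X t)) i j = invmx (X t) i j.
  by move=> tab; rewrite /invmx Xu// [RHS]mxE.
have hx : (\det (X t))^-1 * (\adj (X t)) i j @[t --> within `[a, b] (nbhs x)]
    --> invmx (X x) i j.
  by rewrite -(e x xab); exact: (iffLR (subspace_continuousP _ _) h x xab).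
apply: cvg_trans hx; apply: near_eq_cvg.
by rewrite near_withinE; near=> t => tab; exact: e.
Unshelve. all: by end_near. Qed.

Lemma mxcont_bounded m n (X : R -> 'M[R]_(m, n)) : mxcont X -> bounded_entries a b X.
Proof.
move=> Xc.
have /choice[c hc] : forall ij : 'I_m * 'I_n, exists c : R,
    0 <= c /\ forall t, t \in `[a, b] -> `|X t ij.1 ij.2| <= c.
  by move=> [i j]; have [c c0 hc] := cont_bounded (Xc i j); exists c; rewrite ltW.
exists (\sum_ij c ij) => [|t tab i j]; first by apply: sumr_ge0 => ij _; exact: (hc _).1.
rewrite (le_trans ((hc (i, j)).2 t tab))// (bigD1 (i, j))//= lerDl sumr_ge0// => ij _.
exact: (hc _).1.
Qed.

Lemma ode_mxcont m n (X G : R -> 'M[R]_(m, n)) : ode_solution a b X G -> mxcont X.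
Proof. by move=> /ode_mxP XG i j; apply: abs_continuous_cont; have [] := XG i j. Qed.

End continuity.

(** * Quadratic forms and definite matrices *)

Section dot_product.
Context {R : realType}.

Lemma dotvE k (u v : 'cV[R]_k) : dotv u v = (u^T *m v) ord0 ord0.
Proof. by rewrite mxE; apply: eq_bigr => i _; rewrite mxE. Qed.

Lemma dotvC k (u v : 'cV[R]_k) : dotv u v = dotv v u.
Proof. by apply: eq_bigr => i _; rewrite mulrC. Qed.

Lemma dotvDr k (u v w : 'cV[R]_k) : dotv u (v + w) = dotv u v + dotv u w.
Proof. by rewrite !dotvE mulmxDr mxE. Qed.

Lemma dotvNr k (u v : 'cV[R]_k) : dotv u (- v) = - dotv u v.
Proof. by rewrite !dotvE mulmxN mxE. Qed.

Lemma dotvBr k (u v w : 'cV[R]_k) : dotv u (v - w) = dotv u v - dotv u w.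
Proof. by rewrite dotvDr dotvNr. Qed.

Lemma dotvZr k c (u v : 'cV[R]_k) : dotv u (c *: v) = c * dotv u v.
Proof. by rewrite !dotvE -scalemxAr mxE. Qed.

Lemma dotvDl k (u v w : 'cV[R]_k) : dotv (u + v) w = dotv u w + dotv v w.
Proof. by rewrite dotvC dotvDr !(dotvC w). Qed.

Lemma dotvNl k (u v : 'cV[R]_k) : dotv (- u) v = - dotv u v.
Proof. by rewrite dotvC dotvNr dotvC. Qed.

Lemma dotvBl k (u v w : 'cV[R]_k) : dotv (u - v) w = dotv u w - dotv v w.
Proof. by rewrite dotvDl dotvNl. Qed.

Lemma dotvZl k c (u v : 'cV[R]_k) : dotv (c *: u) v = c * dotv u v.
Proof. by rewrite dotvC dotvZr dotvC. Qed.

Lemma dotv0 k (u : 'cV[R]_k) : dotv u 0 = 0.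
Proof. by rewrite dotvE mulmx0 mxE. Qed.

Lemma dot0v k (u : 'cV[R]_k) : dotv 0 u = 0.
Proof. by rewrite dotvC dotv0. Qed.

Lemma dotv_mull k l (A : 'M[R]_(k, l)) (u : 'cV[R]_l) (v : 'cV[R]_k) :
  dotv (A *m u) v = dotv u (A^T *m v).
Proof. by rewrite !dotvE trmx_mul mulmxA. Qed.

Lemma dotv_col k l (u u' : 'cV[R]_k) (v v' : 'cV[R]_l) :
  dotv (col_mx u v) (col_mx u' v') = dotv u u' + dotv v v'.
Proof. by rewrite !dotvE tr_col_mx mul_row_col mxE. Qed.

Lemma dotv_ge0 k (v : 'cV[R]_k) : 0 <= dotv v v.
Proof. by apply: sumr_ge0 => i _; rewrite -expr2 sqr_ge0. Qed.

Lemma dotv_eq0 k (v : 'cV[R]_k) : dotv v v = 0 -> v = 0.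
Proof.
move=> /eqP; rewrite psumr_eq0 => [/allP h|i _]; last by rewrite -expr2 sqr_ge0.
apply/matrixP => i j; rewrite ord1 mxE.
by have := h i (mem_index_enum _); rewrite /= mulf_eq0 orbb => /eqP.
Qed.

Lemma enormE k (v : 'cV[R]_k) : enorm v ^+ 2 = dotv v v.
Proof. by rewrite sqr_sqrtr// dotv_ge0. Qed.

Lemma quadratic_form_le k (A : 'M[R]_k) (c : R) (v : 'cV[R]_k) : 0 <= c ->
  (forall i j, `|A i j| <= c) ->
  `|dotv v (A *m v)| <= (k * k)%:R * c * dotv v v.
Proof.
move=> c0 hA.
have vv i : v i 0 * v i 0 <= dotv v v.
  by rewrite /dotv (bigD1 i)//= lerDl sumr_ge0// => j _; rewrite -expr2 sqr_ge0.
have vij i j : `|v i 0| * `|v j 0| <= dotv v v.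
  have := vv i; have := vv j; rewrite -!expr2.
  rewrite -(real_normK (num_real (v i 0))) -(real_normK (num_real (v j 0))).
  by nra.
have -> : (k * k)%:R * c * dotv v v = \sum_(i < k) \sum_(j < k) c * dotv v v.
  by rewrite !sumr_const card_ord -mulrnA -[RHS]mulr_natl mulrA.
rewrite /dotv; apply: le_trans (ler_norm_sum _ _ _) _; apply: ler_sum => i _.
rewrite mxE mulr_sumr.
apply: le_trans (ler_norm_sum _ _ _) _; apply: ler_sum => j _.
rewrite !normrM mulrCA; apply: ler_pM; rewrite ?mulr_ge0//; exact: vij.
Qed.

End dot_product.

Section definite_matrices.
Context {R : realType}.

(** The generic lemmas linearD and linearN would also rewrite matrix products,
which are linear functions too. *)
Lemma trmxD m n (A B : 'M[R]_(m, n)) : (A + B)^T = A^T + B^T.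
Proof. exact: linearD. Qed.

Lemma trmxN m n (A : 'M[R]_(m, n)) : (- A)^T = - A^T.
Proof. exact: linearN. Qed.

Lemma unitmx_pos k (A : 'M[R]_k) :
  (forall x : 'cV[R]_k, x != 0 -> 0 < dotv x (A *m x)) -> A \in unitmx.
Proof.
move=> Apos; rewrite -unitmx_tr -row_free_unit -kermx_eq0.
apply/eqP/row_matrixP => i; rewrite row0.
apply: trmx_inj; rewrite trmx0; apply/eqP/negPn/negP => /Apos.
have -> : A *m (row i (kermx A^T))^T = 0; last by rewrite dotv0 ltxx.
by rewrite -[A]trmxK -trmx_mul trmxK -row_mul mulmx_ker row0 trmx0.
Qed.

Lemma posdef_unit k (A : 'M[R]_k) : posdef A -> A \in unitmx.
Proof. by move=> [_ /unitmx_pos]. Qed.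

Lemma posdef_inv k (A : 'M[R]_k) : posdef A -> posdef (invmx A).
Proof.
move=> Apd; have Au := posdef_unit Apd; case: (Apd) => At Apos.
split=> [|x x0]; first by rewrite trmx_inv At.
have -> : dotv x (invmx A *m x) = dotv (invmx A *m x) (A *m (invmx A *m x)).
  by rewrite mulKVmx// dotvC.
apply: Apos; apply: contra_neq x0 => h.
by rewrite -[x](mulKVmx Au) h mulmx0.
Qed.

Lemma posdef_semidef k (A : 'M[R]_k) : posdef A -> possemidef A.
Proof.
move=> [At Apos]; split=> // x; have [->|/Apos/ltW//] := eqVneq x 0.
by rewrite mulmx0 dotv0.
Qed.

Lemma possemidefD k (A B : 'M[R]_k) : possemidef A -> possemidef B ->
  possemidef (A + B).
Proof.
move=> [At A0] [Bt B0]; split=> [|x]; first by rewrite trmxD At Bt.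
by rewrite mulmxDl dotvDr addr_ge0.
Qed.

Lemma possemidefZ k (c : R) (A : 'M[R]_k) : 0 <= c -> possemidef A ->
  possemidef (c *: A).
Proof.
move=> c0 [At A0]; split=> [|x]; first by rewrite linearZ/= At.
by rewrite -scalemxAl dotvZr mulr_ge0.
Qed.

Lemma possemidef_congr k l (A : 'M[R]_k) (B : 'M[R]_(k, l)) : possemidef A ->
  possemidef (B^T *m A *m B).
Proof.
move=> [At A0]; split=> [|x]; first by rewrite !trmx_mul trmxK At mulmxA.
by rewrite -!mulmxA -dotv_mull.
Qed.

Lemma possemidef1 k : possemidef (1%:M : 'M[R]_k).
Proof. by split=> [|x]; rewrite ?trmx1// mul1mx dotv_ge0. Qed.

Lemma posdef_drsubmx k l (A : 'M[R]_(k + l)) : posdef A -> posdef (drsubmx A).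
Proof.
move=> [At Apos]; split=> [|x x0]; first by rewrite trmx_drsub At.
have := Apos (col_mx 0 x); rewrite -[A in A *m _]submxK mul_block_col !mulmx0 !add0r.
rewrite dotv_col dot0v add0r; apply; apply: contra_neq x0 => h.
by rewrite -[x](col_mxKd (0 : 'cV_k)) h linear0.
Qed.

(** The quadratic form of the Schur complement at x is the form of the block
matrix at the vector (x, y) with y = - W^-1 A^T x, which kills the second
block of the image. *)
Lemma possemidef_schur k l (G : 'M[R]_k) (A : 'M[R]_(k, l)) (W : 'M[R]_l) :
  possemidef (block_mx G A A^T W) -> W \in unitmx ->
  possemidef (G - A *m invmx W *m A^T).
Proof.
move=> [Nt Npos] Wu.
move: (Nt); rewrite tr_block_mx => /eq_block_mx[Gt _ _ Wt].
split=> [|x].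
  by rewrite trmxD trmxN !trmx_mul trmxK trmx_inv Gt Wt mulmxA.
have := Npos (col_mx x (- (invmx W *m (A^T *m x)))).
rewrite mul_block_col !mulmxN mulKVmx// subrr dotv_col dotv0 addr0.
by rewrite mulmxBl !mulmxA.
Qed.

End definite_matrices.

(** * Nonnegativity for Riccati equations *)

Section riccati_lower_bound.
Context {R : realType} (a b : R).
Local Notation mu := (@lebesgue_measure R).
Local Notation ode := (ode_solution a b).
Local Notation mxcont := (mxcont a b).

Lemma ode_quadratic k (K G : R -> 'M[R]_k) (v : 'cV[R]_k) : ode K G ->
  ode (fun t => dotv v (K t *m v)) (fun t => dotv v (G t *m v)).
Proof.
move=> KG.
have /ode_mxP/(_ ord0 ord0) h := ode_cstmul v^T (ode_mulmx KG (ode_cst a b v)).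
rewrite (_ : (fun t => _) = fun t => (v^T *m (K t *m v)) ord0 ord0); last first.
  by apply/funext => t; rewrite dotvE.
by apply: ode_ext h _; apply: ae_true => t _; rewrite mulmx0 addr0 dotvE.
Qed.

Lemma mxcont_quadratic_bound k (M : R -> 'M[R]_k) : mxcont M ->
  exists2 c : R, 0 <= c & forall t, t \in `[a, b] -> forall v : 'cV[R]_k,
    `|dotv v (M t *m v)| <= c * dotv v v.
Proof.
move=> /mxcont_bounded[c c0 hc]; exists ((k * k)%:R * c); first by rewrite mulr_ge0.
by move=> t tab v; apply: quadratic_form_le => //; exact: hc.
Qed.

(** Continuity of a quadratic form in time, uniformly over the vectors: this is
what makes the Euler step below independent of the vector. *)
Lemma mxcont_quadratic_near k (M : R -> 'M[R]_k) x (e : R) : mxcont M ->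
  x \in `[a, b] -> 0 < e ->
  exists2 d : R, 0 < d & forall s t, s \in `[a, b] -> t \in `[a, b] ->
    `|s - x| < d -> `|t - x| < d -> forall v : 'cV[R]_k,
    `|dotv v (M t *m v) - dotv v (M s *m v)| <= e * dotv v v.
Proof.
move=> Mc xab e0.
(* A quadratic form has k^2 terms, and two times near x differ by twice the
   tolerance at x. *)
pose e' := e / ((k * k).+1)%:R / 2.
have e'0 : 0 < e' by rewrite !divr_gt0// ltr0n.
have /choice[d hd] : forall ij : 'I_k * 'I_k, exists d : R, 0 < d /\
    forall t, t \in `[a, b] -> `|t - x| < d -> `|M t ij.1 ij.2 - M x ij.1 ij.2| < e'.
  move=> [i j] /=.
  have := iffLR (subspace_continuousP _ _) (Mc i j) x xab.
  move=> /cvgrPdist_lt/(_ _ e'0); rewrite near_withinE => -[d /= d0 hd].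
  exists d; split=> // t tab td; rewrite distrC; apply: hd => //=.
  by rewrite /ball_/= distrC.
exists (\big[Num.min/1]_ij d ij).
  by apply: lt_bigmin => // ij _; exact: (hd ij).1.
move=> s t sab tab sd td v; rewrite -dotvBr -mulmxBl.
apply: le_trans (@quadratic_form_le _ _ _ (e' * 2) _ _ _) _.
- by rewrite mulr_ge0// ltW.
- move=> i j; rewrite !mxE.
  have h1 : `|M t i j - M x i j| < e'.
    by apply: ((hd (i, j)).2 _ tab); apply: lt_le_trans td _; exact: bigmin_le.
  have h2 : `|M s i j - M x i j| < e'.
    by apply: ((hd (i, j)).2 _ sab); apply: lt_le_trans sd _; exact: bigmin_le.
  rewrite (_ : _ - _ = (M t i j - M x i j) - (M s i j - M x i j)); last by ring.
  apply: le_trans (ler_normB _ _) _; lra.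
- rewrite ler_wpM2r ?dotv_ge0// /e' divfK ?pnatr_eq0// mulrCA.
  by rewrite ger_pMr// ler_pdivrMr ?ltr0n// mul1r ler_nat.
Qed.

(** The lower bound K(t) >= - r exp(L (t - a)) I propagates along small intervals,
for every r > 0.  Between s and t = s + h the increment of K is at least
h G(s) up to h r, with G = - K A - A^T K, and K(s) + h G(s) is the congruence
(I - h A)^T K(s) (I - h A) up to h^2.  A congruence multiplies a lower bound by
at most |I - h A|^2 = 1 + O(h), which is the growth rate L of the bound. *)
Lemma riccati_psd k (K A N : R -> 'M[R]_k) : a <= b ->
  ode K (fun t => - (K t *m A t) - (A t)^T *m K t + N t) ->
  mxcont A ->
  (forall t, t \in `[a, b] -> forall v : 'cV[R]_k, 0 <= dotv v (N t *m v)) ->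
  (forall v : 'cV[R]_k, 0 <= dotv v (K a *m v)) ->
  forall v : 'cV[R]_k, 0 <= dotv v (K b *m v).
Proof.
move=> ab hK Ac N0 Ka0 v0.
have Kc := ode_mxcont hK.
pose G t := - (K t *m A t) - (A t)^T *m K t.
have Gc : mxcont G.
  by apply: mxcontD; apply: mxcontN; apply: mxcontM => //; exact: mxcont_tr.
have [c1 c10 hc1] : exists2 c : R, 0 <= c & forall t, t \in `[a, b] ->
    forall v : 'cV[R]_k, `|dotv v (((A t)^T *m K t *m A t) *m v)| <= c * dotv v v.
  apply: mxcont_quadratic_bound; apply: mxcontM => //; apply: mxcontM => //.
  exact: mxcont_tr.
have [c2 c20 hc2] : exists2 c : R, 0 <= c & forall t, t \in `[a, b] ->
    forall v : 'cV[R]_k, `|dotv v ((A t + (A t)^T) *m v)| <= c * dotv v v.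
  by apply: mxcont_quadratic_bound; apply: mxcontD => //; exact: mxcont_tr.
have [c3 c30 hc3] : exists2 c : R, 0 <= c & forall t, t \in `[a, b] ->
    forall v : 'cV[R]_k, `|dotv v (((A t)^T *m A t) *m v)| <= c * dotv v v.
  by apply: mxcont_quadratic_bound; apply: mxcontM => //; exact: mxcont_tr.
(* The constants c2 and c3 bound the growth of |(I - h A) v|^2; the remaining 2
   absorbs the continuity error and the term in h^2, both at most h r. *)
pose L := c2 + c3 + 2.
suff H (r : R) : 0 < r -> - (r * expR (L * (b - a))) * dotv v0 v0 <= dotv v0 (K b *m v0).
  apply/ler_addgt0Pl => e e0.
  have E0 := expR_gt0 (L * (b - a)); have := dotv_ge0 v0.
  have := H (e / (expR (L * (b - a)) * (dotv v0 v0 + 1))).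
  set E := expR _ in E0 *; set D := dotv v0 v0 => + D0.
  have D1 : 0 < D + 1 by rewrite ltr_wpDl.
  rewrite divr_gt0 ?mulr_gt0// => /(_ isT).
  rewrite invfM mulrA mulrAC divfK ?gt_eqF// => h.
  have : e / (D + 1) * D <= e.
    by rewrite mulrAC ler_pdivrMr// ler_pM2l// lerDl.
  by lra.
move=> r0.
pose gam t := r * expR (L * (t - a)).
pose J s t := (forall v, - gam s * dotv v v <= dotv v (K s *m v)) ->
              (forall v, - gam t * dotv v v <= dotv v (K t *m v)).
suff : J a b.
  apply=> v; apply: le_trans (Ka0 v).
  by rewrite /gam subrr mulr0 expR0 mulr1 mulNr oppr_le0 mulr_ge0 ?dotv_ge0 ?ltW.
apply: interval_induction => // [s m t _ _ _ _ h1 h2 /h1/h2//|x ax xb].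
have xab : x \in `[a, b] by rewrite in_itv/= ax.
have [d d0 hd] := mxcont_quadratic_near Gc xab r0.
(* The last bound keeps the error h^2 c1 of the congruence below h r. *)
pose d1 := Num.min d (Num.min (1 / 2) (r / (c1 + 1) / 2)).
have c110 : 0 < c1 + 1 by rewrite ltr_wpDl.
have d10 : 0 < d1 by rewrite !lt_min d0 !divr_gt0.
exists d1 => // s t as_ sx xt tb ds dt hs v.
have [d1d [d1h d1r]] : d1 <= d /\ d1 <= 1 / 2 /\ d1 <= r / (c1 + 1) / 2.
  by rewrite /d1 !ge_min !lexx /= !orbT.
have st : s <= t := le_trans sx xt.
pose h := t - s.
have h0 : 0 <= h by rewrite subr_ge0.
have h1 : h <= 1 by rewrite /h; lra.
have hr : h * c1 <= r.
  have : h <= r / (c1 + 1) by rewrite /h; lra.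
  by rewrite ler_pdivlMr// => h2; nra.
have inab y : s <= y -> y <= t -> y \in `[a, b].
  by move=> sy yt; rewrite in_itv/= (le_trans as_ sy) (le_trans yt tb).
have nearx y : s <= y -> y <= t -> `|y - x| < d.
  by move=> sy yt; rewrite ltr_norml; apply/andP; split; lra.
have D0 := dotv_ge0 v.
set D := dotv v v in D0 *.
have step : dotv v (K s *m v) + h * dotv v (G s *m v) - h * (r * D)
    <= dotv v (K t *m v).
  pose c := dotv v (G s *m v) - r * D.
  have KG := ode_subitv (ode_quadratic v hK) as_ tb.
  have lin : ode_solution s t (fun y => y * c) (fun=> c).
    apply: (@ode_bounded_derivative _ _ _ _ _ `|c|) => // y.
    have := is_deriveM (is_derive_id y (1 : R)) (is_derive_cst c y 1).
    by rewrite /= scaler0 add0r [_ *: 1]mulr1.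
  have := ode_le (odeB KG lin) _ (lexx s) st (lexx t).
  suff Q : {ae mu, forall y, y \in `[s, t] ->
     0 <= dotv v ((- (K y *m A y) - (A y)^T *m K y + N y) *m v) - c}.
    by move=> /(_ Q); rewrite /c /h; lra.
  apply: ae_true => y; rewrite in_itv/= => /andP[sy yt].
  rewrite mulmxDl dotvDr -/(G y).
  have := N0 y (inab y sy yt) v.
  have /ler_normlP[h2 _] := hd s y (inab s (lexx s) st) (inab y sy yt)
    (nearx s (lexx s) st) (nearx y sy yt) v.
  by rewrite /c -/D in h2 *; lra.
have sab := inab s (lexx s) st.
pose w := v - h *: (A s *m v).
have ww : dotv w w = D - h * dotv v ((A s + (A s)^T) *m v)
    + h ^+ 2 * dotv v (((A s)^T *m A s) *m v).
  rewrite /w !dotvBl !dotvBr !dotvZl !dotvZr !dotv_mull mulmxDl dotvDr !mulmxA.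
  by rewrite -/D; ring.
have wKw : dotv w (K s *m w) = dotv v (K s *m v) + h * dotv v (G s *m v)
    + h ^+ 2 * dotv v (((A s)^T *m K s *m A s) *m v).
  rewrite /w mulmxBr !dotvBl !dotvBr -scalemxAr !dotvZl !dotvZr !dotv_mull.
  rewrite /G mulmxDl !mulNmx dotvDr !dotvNr !mulmxA.
  by ring.
have hw := hs w; rewrite ww wKw in hw.
have /ler_normlP[_ b1] := hc1 s sab v.
have /ler_normlP[b2 _] := hc2 s sab v.
have /ler_normlP[_ b3] := hc3 s sab v.
have gs : r <= gam s.
  rewrite /gam ler_pMr// -expR0 ler_expR mulr_ge0 ?subr_ge0// /L.
  by rewrite !addr_ge0.
have gt : gam s * (1 + L * h) <= gam t.
  have -> : gam t = gam s * expR (L * h).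
    by rewrite /gam -mulrA -expRD -mulrDr /h; congr (_ * expR (_ * _)); ring.
  rewrite ler_wpM2l ?expR_ge1Dx//; exact: le_trans (ltW r0) gs.
rewrite -/D in b1 b2 b3 *.
set X1 := dotv v (_ *m v) in b1 hw.
set X2 := dotv v (_ *m v) in b2 hw.
set X3 := dotv v (_ *m v) in b3 hw.
have gs0 : 0 <= gam s := le_trans (ltW r0) gs.
have m1 : h ^+ 2 * X1 <= h * (r * D).
  apply: (@le_trans _ _ (h ^+ 2 * (c1 * D))); first by rewrite ler_wpM2l ?sqr_ge0.
  by rewrite expr2 -mulrA ler_wpM2l// mulrA ler_wpM2r.
have m2 : gam s * (- (h * X2) + h ^+ 2 * X3) <= gam s * (h * ((c2 + c3) * D)).
  have m21 : - (h * X2) <= h * (c2 * D) by rewrite -mulrN ler_wpM2l.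
  have m22 : h ^+ 2 * X3 <= h * (c3 * D).
    apply: (@le_trans _ _ (h ^+ 2 * (c3 * D))); first by rewrite ler_wpM2l ?sqr_ge0.
    by rewrite expr2 -mulrA ler_wpM2l// ler_piMl ?mulr_ge0.
  by apply: ler_wpM2l => //; lra.
have m3 : h * (r * D) <= gam s * (h * D).
  by rewrite mulrCA ler_wpM2r// mulr_ge0.
have m4 : gam s * (1 + L * h) * D <= gam t * D by rewrite ler_wpM2r.
rewrite /L in m4.
by lra.
Qed.

End riccati_lower_bound.

(** * Square root of a nonnegative symmetric matrix *)

Section square_root.
Import complex.
Context {R : realType}.

(** Lagrange interpolation, one node at a time. *)
Lemma interpolation (F : fieldType) (f : F -> F) (s : seq F) : uniq s ->
  exists q : {poly F}, forall x, x \in s -> q.[x] = f x.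
Proof.
elim: s => [|x s IH] /= => [_|/andP[xs /IH[q hq]]]; first by exists 0.
pose w := \prod_(y <- s) ('X - y%:P).
have w0 : w.[x] != 0.
  by have := root_prod_XsubC s x; rewrite (negbTE xs) => /negbT.
exists (q + ((f x - q.[x]) / w.[x]) *: w) => y; rewrite inE => /predU1P[->|ys].
  by rewrite hornerD hornerZ divfK// addrC subrK.
have : root w y by rewrite root_prod_XsubC.
by rewrite hornerD hornerZ => /rootP ->; rewrite mulr0 addr0 hq.
Qed.

Lemma trmx_horner_mx k (A : 'M[R]_k.+1) (q : {poly R}) : A^T = A ->
  (horner_mx A q)^T = horner_mx A q.
Proof.
move=> At; elim/poly_ind: q => [|q c IH]; first by rewrite rmorph0 trmx0.
rewrite rmorphD rmorphM/= horner_mx_X horner_mx_C linearD/= tr_scalar_mx.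
rewrite trmx_mul IH At; congr (_ + _).
exact: (comm_mx_horner _ (comm_mx_refl A)).
Qed.

Lemma possemidef_eigenvalue_ge0 k (A : 'M[R]_k) (x : R) : possemidef A ->
  eigenvalue A x -> 0 <= x.
Proof.
move=> [At A0] /eigenvalueP[v vA v0].
have v0' : 0 < dotv v^T v^T.
  rewrite lt_def dotv_ge0 andbT; apply: contra_neq v0 => /dotv_eq0 h.
  by rewrite -[v]trmxK h trmx0.
have := A0 v^T; rewrite -{1}At -trmx_mul vA linearZ/= dotvZr.
by rewrite pmulr_lge0.
Qed.

(** The spectral theorem for Hermitian complex matrices, with the information
that the eigenvalues of a real symmetric matrix are real.  The change of basis
may stay complex: only polynomials in A are taken from it. *)
Lemma symmetric_diagonalizable k (A : 'M[R]_k) : A^T = A ->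
  exists (P : 'M[R[i]]_k) (d : 'rV[R]_k), [/\ P \in unitmx,
    map_mx (real_complex R) A =
      invmx P *m diag_mx (map_mx (real_complex R) d) *m P &
    forall i, eigenvalue A (d ord0 i)].
Proof.
move=> At; pose B := map_mx (real_complex R) A.
have Bsym : B \is symmetricmx.
  by apply/is_hermitianmxP; rewrite expr0 scale1r map_mx_id// /B map_trmx At.
have Breal : B \is a realmx.
  by apply/mxOverP => i j; rewrite mxE; apply/complex_realP; exists (A i j).
have Bh := realsym_hermsym Bsym Breal.
have /orthomx_spectralP BE := hermitian_normalmx Bh.
have Pu := spectral_unit B.
pose d : 'rV[R]_k := map_mx (fun z => complex.Re z) (spectral_diag B).
have dE : map_mx (real_complex R) d = spectral_diag B.
  apply/matrixP => i j; rewrite !mxE.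
  have /mxOverP/(_ i j) := hermitian_spectral_diag_real Bh.
  by move=> /complex_realP[x ->].
exists (spectralmx B), d; split; [exact: Pu | rewrite dE; exact: BE | move=> i].
rewrite -(eigenvalue_map (real_complex R)) -/B.
apply/eigenvalueP; exists (row i (spectralmx B)); last first.
  apply/eqP => r0; have := congr1 (row i) (mulmxV Pu).
  rewrite row_mul r0 mul0mx => /rowP/(_ i); rewrite !mxE eqxx => /esym/eqP.
  by rewrite oner_eq0.
rewrite {2}BE -row_mul !mulmxA mulmxV// mul1mx -dE.
by apply/rowP => j; rewrite mul_diag_mx !mxE.
Qed.

(** Let q be a real polynomial that takes at each eigenvalue the value of its
fourth root, and B = q(A).  Then B is real and symmetric and B^4 = A, so that
B^2 is a square root of A; it is nonnegative as the square of a symmetric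
matrix. *)
Lemma possemidef_sqrt k (A : 'M[R]_k) : possemidef A ->
  exists S : 'M[R]_k, possemidef S /\ S *m S = A.
Proof.
case: k A => [|k] A Apsd.
  by exists A; split=> //; rewrite [A]flatmx0 mulmx0.
have [At A0] := Apsd.
have [P [d [Pu AE dA]]] := symmetric_diagonalizable At.
have [q hq] := interpolation (fun x => Num.sqrt (Num.sqrt x))
  (undup_uniq [seq d ord0 i | i <- enum 'I_k.+1]).
have qd i : q.[d ord0 i] = Num.sqrt (Num.sqrt (d ord0 i)).
  by apply: hq; rewrite mem_undup; apply: map_f; rewrite mem_enum.
pose B := horner_mx A q.
have Bt : B^T = B := trmx_horner_mx q At.
have B4 : B *m B *m (B *m B) = A.
  have -> : B *m B *m (B *m B) = horner_mx A (q ^+ 2 * q ^+ 2).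
    by rewrite !expr2 !rmorphM.
  apply: (map_mx_inj (f := real_complex R)).
  rewrite map_horner_mx AE.
  rewrite (horner_mx_uconjC _ _ Pu) horner_mx_diag.
  congr (_ *m diag_mx _ *m _); apply/rowP => i; rewrite !mxE horner_map/=.
  have d0 : 0 <= d ord0 i := possemidef_eigenvalue_ge0 Apsd (dA i).
  by rewrite hornerM horner_exp qd !sqr_sqrtr ?sqrtr_ge0// -expr2 sqr_sqrtr.
exists (B *m B); split=> //; split=> [|x]; first by rewrite trmx_mul Bt.
by rewrite -mulmxA -{1}Bt -dotv_mull dotv_ge0.
Qed.

Lemma enorm_sqrtmx k (A : 'M[R]_k) (v : 'cV[R]_k) : possemidef A ->
  enorm (sqrtmx A *m v) ^+ 2 = dotv v (A *m v).
Proof.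
move=> /possemidef_sqrt[S hS]; rewrite enormE /sqrtmx.
case: xgetP => [S' _ [[St _] <-]|/(_ S)]; last by [].
by rewrite dotv_mull St mulmxA.
Qed.

End square_root.

(** * Moore-Penrose inverse of a block identity *)

Section pseudoinverse.
Context {R : realType}.

Lemma penrose_uniq m n (F : 'M[R]_(m, n)) (G G' : 'M[R]_(n, m)) :
  penrose F G -> penrose F G' -> G = G'.
Proof.
move=> [g1 g2 g3 g4] [h1 h2 h3 h4].
have e1 : F *m G = F *m G'.
  by rewrite -[LHS]g3 -{1}h1 -mulmxA trmx_mul g3 h3 mulmxA g1.
have e2 : G *m F = G' *m F.
  rewrite -[LHS]g4 -{1}h1 !mulmxA -[_ *m G' *m F]mulmxA trmx_mul h4 g4.
  by rewrite -mulmxA [F *m (G *m F)]mulmxA g1.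
by rewrite -g2 -mulmxA e1 mulmxA e2 h2.
Qed.

Lemma mpinv_eq m n (F : 'M[R]_(m, n)) (G : 'M[R]_(n, m)) :
  penrose F G -> mpinv F = G.
Proof.
move=> FG; rewrite /mpinv.
by case: xgetP => [G' _ FG'|/(_ G)//]; exact: penrose_uniq FG' FG.
Qed.

Lemma mpinv_block_id r a b :
  mpinv (block_mx 1%:M 0 0 0 : 'M[R]_(r + a, r + b)) = block_mx 1%:M 0 0 0.
Proof.
by apply: mpinv_eq; split;
  rewrite !mulmx_block ?tr_block_mx !(mulmx1, mul1mx, mulmx0, mul0mx, addr0, trmx1, trmx0).
Qed.

Lemma mul_block_id_col r a b (v : 'cV[R]_(r + b)) :
  (block_mx 1%:M 0 0 0 : 'M[R]_(r + a, r + b)) *m v = col_mx (usubmx v) 0.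
Proof.
by rewrite -{1}[v]vsubmxK mul_block_col !(mul1mx, mul0mx) !addr0.
Qed.

End pseudoinverse.

(** * Integrable products and block equations *)

Section integrability.
Context {R : realType} (a b : R).
Local Notation mu := (@lebesgue_measure R).

Lemma measurable_dotv k (u v : R -> 'cV[R]_k) :
  (forall i, measurable_fun `[a, b] (fun t => u t i ord0)) ->
  (forall i, measurable_fun `[a, b] (fun t => v t i ord0)) ->
  measurable_fun `[a, b] (fun t => dotv (u t) (v t)).
Proof.
by move=> um vm; apply: measurable_sum => i; exact: measurable_funM.
Qed.

(** The product is dominated by |u|^2 + |v|^2. *)
Lemma integrable_dotv k (u v : R -> 'cV[R]_k) : inL2 a b u -> inL2 a b v ->
  mu.-integrable `[a, b] (EFin \o (fun t => dotv (u t) (v t))).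
Proof.
move=> [um ui] [vm vi].
apply: le_integrable (integrableD _ ui vi) => //.
  by apply/measurable_EFinP; exact: measurable_dotv.
move=> t _ /=; rewrite lee_fin !enormE [leRHS]ger0_norm ?addr_ge0 ?dotv_ge0//.
have := dotv_ge0 (u t + v t); have := dotv_ge0 (u t - v t).
rewrite !(dotvDl, dotvBl, dotvDr, dotvBr, dotvNl, dotvNr) (dotvC (v t)) => h1 h2.
have := dotv_ge0 (u t); have := dotv_ge0 (v t).
by rewrite ler_norml => *; apply/andP; split; lra.
Qed.

Lemma integrable_quadratic k (M : R -> 'M[R]_k) (u : R -> 'cV[R]_k) :
  inL2 a b u -> mxcont a b M ->
  mu.-integrable `[a, b] (EFin \o (fun t => dotv (u t) (M t *m u t))).
Proof.
move=> [um ui] Mc.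
have [c c0 hc] := mxcont_quadratic_bound Mc.
apply: le_integrable (integrableZl _ c ui) => //.
  apply/measurable_EFinP; apply: measurable_dotv => // i.
  rewrite (_ : (fun t => _) = fun t => \sum_j M t i j * u t j ord0); last first.
    by apply/funext => t; rewrite mxE.
  apply: measurable_sum => j.
  apply: measurable_funM => //.
  by apply: subspace_continuous_measurable_fun => //; exact: Mc.
move=> t tab /=; rewrite lee_fin enormE.
apply: le_trans (hc t tab (u t)) _.
by rewrite [leRHS]ger0_norm// mulr_ge0 ?dotv_ge0.
Qed.

Lemma mxcont_dotv k (u v : R -> 'cV[R]_k) : mxcont a b u -> mxcont a b v ->
  {within `[a, b], continuous (fun t => dotv (u t) (v t))}.
Proof. by move=> uc vc; apply: cont_sum => i; exact: contM. Qed.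

Lemma integrable_cont (f : R -> R) : {within `[a, b], continuous f} ->
  mu.-integrable `[a, b] (EFin \o f).
Proof.
by move=> fc; apply: continuous_compact_integrable => //; exact: segment_compact.
Qed.

Lemma ode_dotv k (X G Y H : R -> 'cV[R]_k) :
  ode_solution a b X G -> ode_solution a b Y H ->
  ode_solution a b (fun t => dotv (X t) (Y t))
    (fun t => dotv (G t) (Y t) + dotv (X t) (H t)).
Proof.
move=> /ode_mxP XG /ode_mxP YH.
have h : ode_solution a b (fun t => dotv (X t) (Y t))
    (fun t => \sum_i (G t i ord0 * Y t i ord0 + X t i ord0 * H t i ord0)).
  by apply: ode_sum => i; exact: odeM.
by apply: ode_ext h _; apply: ae_true => t _; rewrite big_split.
Qed.

Lemma ode_scale (c : R) (f g : R -> R) : ode_solution a b f g ->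
  ode_solution a b (fun t => c * f t) (fun t => c * g t).
Proof.
move=> fg; apply: ode_ext (odeM (ode_cst a b c) fg) _.
by apply: ae_true => t _; rewrite mul0r add0r.
Qed.

(** The zero rows of a solution have derivative zero, so the corresponding rows
of the right-hand side form an algebraic equation. *)
Lemma ode_col0 k l n (X : R -> 'M[R]_(k, n)) (G : R -> 'M[R]_(k + l, n)) :
  ode_solution a b (fun t => col_mx (X t) 0) G ->
  ode_solution a b X (fun t => usubmx (G t)) /\
  {ae mu, forall t, t \in `[a, b] -> dsubmx (G t) = 0}.
Proof.
move=> XG; split.
  apply/ode_mxP => i j; have /ode_mxP/(_ (lshift l i) j) h := XG.
  rewrite (_ : (fun t => X t i j) = fun t => col_mx (X t) 0 (lshift l i) j); last first.
    by apply/funext => t; rewrite col_mxEu.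
  by apply: ode_ext h _; apply: ae_true => t _; rewrite [RHS]mxE.
have [_] := XG; apply: ae_imply => t h /h /is_derive_mxP {}h.
apply/matrixP => i j; rewrite !mxE; have := h (rshift k i) j.
have -> : (fun t => col_mx (X t) 0 (rshift k i) j) = cst 0.
  by apply/funext => s; rewrite col_mxEd mxE.
by move=> [_ <-]; rewrite derive_cst.
Qed.

End integrability.

(** * Elimination of the algebraic equations *)

Section symmetric_blocks.
Context {R : realType}.

Lemma sym_submxK k l (A : 'M[R]_(k + l)) : A^T = A ->
  A = block_mx (ulsubmx A) (ursubmx A) (ursubmx A)^T (drsubmx A).
Proof. by move=> At; rewrite trmx_ursub At submxK. Qed.

Lemma possemidef_submx_schur k l (A : 'M[R]_(k + l)) : posdef A ->
  possemidef (ulsubmx A - ursubmx A *m invmx (drsubmx A) *m (ursubmx A)^T).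
Proof.
move=> Apd; apply: possemidef_schur.
  by rewrite -sym_submxK; [exact: posdef_semidef | case: Apd].
exact/posdef_unit/posdef_drsubmx.
Qed.

Lemma possemidef_drsubmx k l (A : 'M[R]_(k + l)) : possemidef A ->
  possemidef (drsubmx A).
Proof.
move=> [At A0]; split=> [|x]; first by rewrite trmx_drsub At.
have := A0 (col_mx 0 x); rewrite -[A in A *m _]submxK mul_block_col !mulmx0 !add0r.
by rewrite dotv_col dot0v add0r.
Qed.

Lemma posdef_scalarD k (e : R) (A : 'M[R]_k) : 0 < e -> possemidef A ->
  posdef (e%:M + A).
Proof.
move=> e0 [At A0]; split=> [|x x0]; first by rewrite trmxD tr_scalar_mx At.
rewrite mulmxDl mul_scalar_mx dotvDr dotvZr ltr_wpDr// mulr_gt0//.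
by rewrite lt_def dotv_ge0 andbT; apply: contra_neq x0; exact: dotv_eq0.
Qed.

End symmetric_blocks.

(** Replaces every product by a variable, so that an identity that is linear in
the products can be decided entry by entry.  The ring structures inferred for
the same product in two places are convertible but may differ syntactically;
set identifies such occurrences, while generalize does not. *)
Ltac generalize_products :=
  repeat match goal with
  | |- context [@mulmx ?R ?m ?n ?p ?A ?B] =>
      let x := fresh "x" in set x := (@mulmx R m n p A B); clearbody x
  end.

Section elimination.
Context {R : realType} {r a b : nat}.
Variables (C1 : 'M[R]_r) (C2 : 'M[R]_(r, b)) (C3 : 'M[R]_(a, r)) (C4 : 'M[R]_(a, b)).
Variables (Q1 : 'M[R]_r) (Q2 : 'M[R]_(r, a)) (Q4 : 'M[R]_a).
Variables (S1 : 'M[R]_r) (S2 : 'M[R]_(r, b)) (S4 : 'M[R]_b) (eps : R).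

Let W := eps%:M + S4 + C4^T *m invmx Q4 *m C4.
Let M := invmx W.
Let A := C3^T *m invmx Q4 *m C4 + S2.
Let B := C2^T - C4^T *m invmx Q4 *m Q2^T.
Let Ce := - C1^T + C3^T *m invmx Q4 *m Q2^T + A *m M *m B.
Let Qe := - (eps^-1 *: (A *m M *m A^T)) + 1%:M
  + eps^-1 *: (S1 + C3^T *m invmx Q4 *m C3).
Let Se := eps *: (Q1 - Q2 *m invmx Q4 *m Q2^T + B^T *m M *m B).

(** The last hypothesis gives z2, and substituting it in the preceding one gives
W q2 = eps B z1 - A^T q1.  The two other equations follow by substituting z2
and then q2. *)
Lemma eliminate_blocks (z1 : 'cV[R]_r) (z2 : 'cV[R]_a) (q1 : 'cV[R]_r) (q2 : 'cV[R]_b) :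
  eps != 0 -> Q4 \in unitmx -> W \in unitmx -> Q4^T = Q4 -> W^T = W ->
  - (C2^T *m z1 + C4^T *m z2) + eps^-1 *: (S2^T *m q1 + S4 *m q2) + q2 = 0 ->
  C3 *m q1 + C4 *m q2 + eps *: (Q2^T *m z1 + Q4 *m z2) = 0 ->
  [/\ q2 = M *m (eps *: (B *m z1) - A^T *m q1),
    - (C1^T *m z1 + C3^T *m z2) + eps^-1 *: (S1 *m q1 + S2 *m q2) + q1
      = Ce *m z1 + Qe *m q1 &
    C1 *m q1 + C2 *m q2 + eps *: (Q1 *m z1 + Q2 *m z2)
      = - (Ce)^T *m q1 + Se *m z1].
Proof.
move=> eps_neq0 Q4u Wu Q4t Wt e2 e4.
have Q4it : (invmx Q4)^T = invmx Q4 by rewrite trmx_inv Q4t.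
have Mt : M^T = M by rewrite /M trmx_inv Wt.
have [w wE] : exists w, w = C3 *m q1 + C4 *m q2 by eexists.
have z2E : eps *: z2 = - (invmx Q4 *m w + eps *: (invmx Q4 *m (Q2^T *m z1))).
  have := congr1 (mulmx (invmx Q4)) e4.
  rewrite mulmx0 -wE mulmxDr -scalemxAr mulmxDr (mulKmx Q4u) scalerDr addrA => /eqP.
  by rewrite addrC addr_eq0 => /eqP.
have Wq2 : W *m q2 = eps *: (B *m z1) - A^T *m q1.
  have e2' : - (eps *: (C2^T *m z1) + C4^T *m (eps *: z2))
     + (S2^T *m q1 + S4 *m q2) + eps *: q2 = 0.
    have := congr1 ( *:%R eps) e2.
    by rewrite scaler0 !scalerDr scalerN scalerDr !scalerA mulfV// !scale1r -scalemxAr.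
  rewrite z2E mulmxN mulmxDr -scalemxAr wE !mulmxDr in e2'.
  rewrite /W /B /A.
  rewrite !mulmxDl mulNmx mul_scalar_mx scalerDr trmxD !trmx_mul trmxK Q4it.
  rewrite mulmxDl -!mulmxA scalerN.
  by move: e2'; generalize_products => e2'; apply/matrixP => i j; move/matrixP/(_ i j): e2';
    rewrite !mxE; lra.
have q2E : q2 = M *m (eps *: (B *m z1) - A^T *m q1).
  by rewrite -Wq2 [RHS](mulKmx Wu).
have Aq2 : C3^T *m (invmx Q4 *m (C4 *m q2)) + S2 *m q2
    = eps *: (A *m (M *m (B *m z1))) - A *m (M *m (A^T *m q1)).
  have -> : C3^T *m (invmx Q4 *m (C4 *m q2)) + S2 *m q2 = A *m q2.
    by rewrite /A mulmxDl !mulmxA.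
  by rewrite q2E !mulmxBr -!scalemxAr.
have Btq2 : C2 *m q2 - Q2 *m (invmx Q4 *m (C4 *m q2))
    = eps *: (B^T *m (M *m (B *m z1))) - B^T *m (M *m (A^T *m q1)).
  have -> : C2 *m q2 - Q2 *m (invmx Q4 *m (C4 *m q2)) = B^T *m q2.
    by rewrite /B trmxD trmxN !trmx_mul !trmxK Q4it mulmxBl !mulmxA.
  by rewrite q2E !mulmxBr -!scalemxAr.
have z2E' : z2 = - (eps^-1 *: (invmx Q4 *m (C3 *m q1)) + eps^-1 *: (invmx Q4 *m (C4 *m q2))
   + invmx Q4 *m (Q2^T *m z1)).
  apply: (scalerI eps_neq0); rewrite z2E scalerN !scalerDr !scalerA mulfV// !scale1r.
  by rewrite wE mulmxDr.
split; first exact: q2E.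
  move: Aq2; rewrite /Ce /Qe; move: (A) (B) (M) => A' B' M' Aq2.
  rewrite z2E' mulmxN !mulmxDr -!scalemxAr !mulmxDl !mulNmx mul1mx.
  rewrite -!scalemxAl mulmxDl -!mulmxA !scalerDr.
  move: Aq2; generalize_products => Aq2; apply/matrixP => i j; move/matrixP/(_ i j): Aq2.
  rewrite !mxE => h; have {h} := congr1 ( *%R eps^-1) h.
  by rewrite mulrBr mulKf// mulrDr; lra.
move: Btq2 Mt; rewrite /Ce /Se; move: (A) (B) (M) => A' B' M' Btq2 Mt.
have -> : (- C1^T + C3^T *m invmx Q4 *m Q2^T + A' *m M' *m B')^T
    = - C1 + Q2 *m invmx Q4 *m C3 + B'^T *m M' *m A'^T.
  by rewrite !trmxD trmxN !trmx_mul !trmxK Q4it Mt !mulmxA.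
rewrite scalerDr [eps *: (Q2 *m z2)]scalemxAr z2E wE.
rewrite mulmxN mulmxDr mulmxDr mulmxDr -!scalemxAr -!scalemxAl !mulNmx !mulmxDl !mulNmx -!mulmxA.
move: Btq2; generalize_products => Btq2; apply/matrixP => i j; move/matrixP/(_ i j): Btq2.
by rewrite !mxE; lra.
Qed.

End elimination.

Section coefficients.
Context {R : realType} {r a b p : nat}.
Variables (C : R -> 'M[R]_(r + a, r + b)) (H : R -> 'M[R]_(p, r + b)).
Variables (Q : R -> 'M[R]_(r + a)) (Rw : R -> 'M[R]_p) (eps t : R).
Hypotheses (eps_gt0 : 0 < eps) (Q_posdef : posdef (Q t)) (R_posdef : posdef (Rw t)).

Let C1 : 'M[R]_(r, r) := ulsubmx (C t).
Let C2 : 'M[R]_(r, b) := ursubmx (C t).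
Let C3 : 'M[R]_(a, r) := dlsubmx (C t).
Let C4 : 'M[R]_(a, b) := drsubmx (C t).
Let Q1 : 'M[R]_(r, r) := ulsubmx (invmx (Q t)).
Let Q2 : 'M[R]_(r, a) := ursubmx (invmx (Q t)).
Let Q4 : 'M[R]_(a, a) := drsubmx (invmx (Q t)).
Let S : 'M[R]_(r + b, r + b) := (H t)^T *m Rw t *m H t.
Let S1 : 'M[R]_(r, r) := ulsubmx S.
Let S2 : 'M[R]_(r, b) := ursubmx S.
Let S4 : 'M[R]_(b, b) := drsubmx S.
Let W := Wmx C H Q Rw eps t.
Let M := Mmx C H Q Rw eps t.
Let A := Amx C H Q Rw t.
Let B := Bmx C Q t.

Let Qi_posdef : posdef (invmx (Q t)) := posdef_inv Q_posdef.

Lemma Q4_posdef : posdef Q4.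
Proof. exact: posdef_drsubmx. Qed.

Let Q4i_semidef : possemidef (invmx Q4).
Proof. exact/posdef_semidef/posdef_inv/Q4_posdef. Qed.

Let S_semidef : possemidef S.
Proof. exact/possemidef_congr/posdef_semidef. Qed.

Lemma Wmx_posdef : posdef W.
Proof.
rewrite /W /Wmx -addrA; apply: posdef_scalarD => //.
by apply: possemidefD; [exact: possemidef_drsubmx | exact: possemidef_congr].
Qed.

Lemma Mmx_posdef : posdef M.
Proof. exact: posdef_inv Wmx_posdef. Qed.

Lemma Seps_semidef : possemidef (Seps C H Q Rw eps t).
Proof.
apply: possemidefZ; first exact: ltW.
apply: possemidefD; first exact: possemidef_submx_schur.
by apply: possemidef_congr; exact: posdef_semidef Mmx_posdef.
Qed.

(** Apart from the identity, Qeps is eps^-1 times a Schur complement: that of W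
in the matrix D + S + (C3 C4)^T Q4^-1 (C3 C4), where D is eps I on the lower
block. *)
Lemma Qeps_semidef : possemidef (Qeps C H Q Rw eps t).
Proof.
rewrite /Qeps -/C3 -/Q4 -/S -/S1 -/A -/M.
rewrite addrAC addrC -scalerN -scalerDr [- _ + _]addrC.
apply: possemidefD; first exact: possemidef1.
apply: possemidefZ; first by rewrite invr_ge0 ltW.
apply: possemidef_schur; last exact: posdef_unit Wmx_posdef.
pose D : 'M[R]_(r + b) := block_mx 0 0 0 eps%:M.
have D_semidef : possemidef D.
  split=> [|x]; first by rewrite /D tr_block_mx !trmx0 tr_scalar_mx.
  rewrite -[x]vsubmxK /D mul_block_col !mul0mx !add0r dotv_col dotv0 add0r.
  by rewrite mul_scalar_mx dotvZr mulr_ge0 ?dotv_ge0// ltW.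
rewrite [X in possemidef X](_ : _ = D + S + (row_mx C3 C4)^T *m invmx Q4 *m row_mx C3 C4).
  by apply: possemidefD; [exact: possemidefD | exact: possemidef_congr].
have [St _] := S_semidef; have [Q4it _] := Q4i_semidef.
rewrite [S in D + S](sym_submxK St) /D tr_row_mx mul_col_mx mul_col_row !add_block_mx.
rewrite !add0r /A /Amx /W /Wmx trmxD !trmx_mul !trmxK Q4it.
congr block_mx; rewrite ?mulmxA//; first by rewrite addrC.
by rewrite addrC.
Qed.

Lemma eliminate (z1 : 'cV[R]_r) (z2 : 'cV[R]_a) (q1 : 'cV[R]_r) (q2 : 'cV[R]_b) :
  - (C2^T *m z1 + C4^T *m z2) + eps^-1 *: (S2^T *m q1 + S4 *m q2) + q2 = 0 ->
  C3 *m q1 + C4 *m q2 + eps *: (Q2^T *m z1 + Q4 *m z2) = 0 ->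
  [/\ q2 = M *m (eps *: (B *m z1) - A^T *m q1),
    - (C1^T *m z1 + C3^T *m z2) + eps^-1 *: (S1 *m q1 + S2 *m q2) + q1
      = Ceps C H Q Rw eps t *m z1 + Qeps C H Q Rw eps t *m q1 &
    C1 *m q1 + C2 *m q2 + eps *: (Q1 *m z1 + Q2 *m z2)
      = - (Ceps C H Q Rw eps t)^T *m q1 + Seps C H Q Rw eps t *m z1].
Proof.
apply: eliminate_blocks.
- by rewrite gt_eqF.
- exact: posdef_unit Q4_posdef.
- exact: posdef_unit Wmx_posdef.
- by have [] := Q4_posdef.
- by have [] := Wmx_posdef.
Qed.

Lemma eliminate_vector (z : 'cV[R]_(r + a)) (q : 'cV[R]_(r + b)) (u : 'cV[R]_p) :
  eps *: u = Rw t *m H t *m q ->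
  dsubmx (- (C t)^T *m z + (H t)^T *m u + q) = 0 ->
  dsubmx (C t *m q + eps *: (invmx (Q t) *m z)) = 0 ->
  [/\ dsubmx q = M *m (eps *: (B *m usubmx z) - A^T *m usubmx q),
    usubmx (- (C t)^T *m z + (H t)^T *m u + q)
      = Ceps C H Q Rw eps t *m usubmx z + Qeps C H Q Rw eps t *m usubmx q &
    usubmx (C t *m q + eps *: (invmx (Q t) *m z))
      = - (Ceps C H Q Rw eps t)^T *m usubmx q + Seps C H Q Rw eps t *m usubmx z].
Proof.
move=> uE.
have [St _] := S_semidef; have [Qit _] := Qi_posdef.
have HuE : (H t)^T *m u = eps^-1 *: (S *m q).
  rewrite /S -!mulmxA [Rw t *m _]mulmxA -uE -scalemxAr scalerA mulVf ?gt_eqF//.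
  by rewrite scale1r.
have zE : - (C t)^T *m z + (H t)^T *m u + q = col_mx
    (- (C1^T *m usubmx z + C3^T *m dsubmx z)
      + eps^-1 *: (S1 *m usubmx q + S2 *m dsubmx q) + usubmx q)
    (- (C2^T *m usubmx z + C4^T *m dsubmx z)
      + eps^-1 *: (S2^T *m usubmx q + S4 *m dsubmx q) + dsubmx q).
  rewrite HuE -{1}[C t]submxK tr_block_mx -{1}[z]vsubmxK mulNmx mul_block_col.
  rewrite {1}(sym_submxK St) -{1 2}[q]vsubmxK mul_block_col.
  by rewrite scale_col_mx opp_col_mx !add_col_mx.
have qE : C t *m q + eps *: (invmx (Q t) *m z) = col_mx
    (C1 *m usubmx q + C2 *m dsubmx q + eps *: (Q1 *m usubmx z + Q2 *m dsubmx z))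
    (C3 *m usubmx q + C4 *m dsubmx q + eps *: (Q2^T *m usubmx z + Q4 *m dsubmx z)).
  rewrite -{1}[C t]submxK -{1}[q]vsubmxK mul_block_col.
  rewrite {1}(sym_submxK Qit) -{1}[z]vsubmxK mul_block_col.
  by rewrite scale_col_mx add_col_mx.
by rewrite zE qE !col_mxKu !col_mxKd; exact: eliminate.
Qed.

End coefficients.

(** The lower rows of the initial condition determine the free vector d, and
Q4tilde is the Schur complement that results from substituting it. *)
Lemma eliminate_initial (R : realType) (r a : nat) (Q0 : 'M[R]_(r + a)) (eps : R)
    (q1 z1 : 'cV[R]_r) (d : 'cV[R]_(r + a)) : posdef Q0 -> eps != 0 ->
  usubmx d = 0 ->
  eps^-1 *: col_mx q1 0 = invmx Q0 *m (col_mx z1 0 - d) ->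
  q1 = eps *: (Q4tilde Q0 *m z1).
Proof.
move=> /posdef_inv Q0i eps0 d1; have [Q0it _] := Q0i.
have Q4u := posdef_unit (posdef_drsubmx Q0i).
rewrite {1}(sym_submxK Q0it) -{1}[d]vsubmxK d1 opp_col_mx add_col_mx oppr0 addr0 add0r.
rewrite mul_block_col scale_col_mx scaler0 => /eq_col_mx[e1 e2].
have d2 : dsubmx d = invmx (drsubmx (invmx Q0)) *m ((ursubmx (invmx Q0))^T *m z1).
  move/esym/eqP: e2; rewrite mulmxN subr_eq0 => /eqP ->.
  by rewrite mulKmx.
apply: (scalerI (invr_neq0 eps0)); rewrite e1 scalerA mulVf// scale1r d2.
by rewrite /Q4tilde mulmxBl mulmxN !mulmxA.
Qed.

(** * Continuity of the coefficients of the filter *)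

Section coefficient_continuity.
Context {R : realType} (t0 T : R).
Local Notation mxcont := (mxcont t0 T).

Lemma mxcont_ulsubmx m1 m2 n1 n2 (X : R -> 'M[R]_(m1 + m2, n1 + n2)) :
  mxcont X -> mxcont (fun t => ulsubmx (X t)).
Proof.
by move=> Xc i j; apply: cont_eq (Xc (lshift _ i) (lshift _ j)) => t; rewrite !mxE.
Qed.

Lemma mxcont_ursubmx m1 m2 n1 n2 (X : R -> 'M[R]_(m1 + m2, n1 + n2)) :
  mxcont X -> mxcont (fun t => ursubmx (X t)).
Proof.
by move=> Xc i j; apply: cont_eq (Xc (lshift _ i) (rshift _ j)) => t; rewrite !mxE.
Qed.

Lemma mxcont_dlsubmx m1 m2 n1 n2 (X : R -> 'M[R]_(m1 + m2, n1 + n2)) :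
  mxcont X -> mxcont (fun t => dlsubmx (X t)).
Proof.
by move=> Xc i j; apply: cont_eq (Xc (rshift _ i) (lshift _ j)) => t; rewrite !mxE.
Qed.

Lemma mxcont_drsubmx m1 m2 n1 n2 (X : R -> 'M[R]_(m1 + m2, n1 + n2)) :
  mxcont X -> mxcont (fun t => drsubmx (X t)).
Proof.
by move=> Xc i j; apply: cont_eq (Xc (rshift _ i) (rshift _ j)) => t; rewrite !mxE.
Qed.

Lemma mxcont_col_mx m1 m2 n (X : R -> 'M[R]_(m1, n)) (Y : R -> 'M[R]_(m2, n)) :
  mxcont X -> mxcont Y -> mxcont (fun t => col_mx (X t) (Y t)).
Proof.
move=> Xc Yc i j; rewrite -(splitK i); case: (fintype.split i) => k /=.
  by apply: cont_eq (Xc k j) => t; rewrite col_mxEu.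
by apply: cont_eq (Yc k j) => t; rewrite col_mxEd.
Qed.

Variables (r a b p : nat).
Variables (C : R -> 'M[R]_(r + a, r + b)) (H : R -> 'M[R]_(p, r + b)).
Variables (Q : R -> 'M[R]_(r + a)) (Rw : R -> 'M[R]_p) (eps : R).
Hypotheses (eps_gt0 : 0 < eps).
Hypotheses (Cc : mxcont C) (Hc : mxcont H) (Qic : mxcont (fun t => invmx (Q t))).
Hypotheses (Rc : mxcont Rw).
Hypothesis Q_posdef : forall t, t \in `[t0, T] -> posdef (Q t).
Hypothesis R_posdef : forall t, t \in `[t0, T] -> posdef (Rw t).

Let C3c := mxcont_dlsubmx Cc.
Let C4c := mxcont_drsubmx Cc.
Let Q2c := mxcont_ursubmx Qic.

Let Q4ic : mxcont (fun t => invmx (drsubmx (invmx (Q t)))).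
Proof.
apply: mxcont_inv; last exact: mxcont_drsubmx.
by move=> t tab; apply/posdef_unit/Q4_posdef/Q_posdef.
Qed.

Let Sc : mxcont (fun t => (H t)^T *m Rw t *m H t).
Proof. by apply: mxcontM => //; apply: mxcontM => //; exact: mxcont_tr. Qed.

Lemma mxcont_Mmx : mxcont (Mmx C H Q Rw eps).
Proof.
apply: mxcont_inv => [t tab|].
  by apply/posdef_unit/Wmx_posdef => //; [exact: Q_posdef|exact: R_posdef].
apply: mxcontD.
  by apply: mxcontD; [exact: mxcont_cst | exact: mxcont_drsubmx].
by apply: mxcontM => //; apply: mxcontM => //; exact: mxcont_tr.
Qed.

Lemma mxcont_Amx : mxcont (Amx C H Q Rw).
Proof.
apply: mxcontD; last exact: mxcont_ursubmx.
by apply: mxcontM => //; apply: mxcontM => //; exact: mxcont_tr.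
Qed.

Lemma mxcont_Bmx : mxcont (Bmx C Q).
Proof.
apply: mxcontD; first by apply: mxcont_tr; exact: mxcont_ursubmx.
apply: mxcontN; apply: mxcontM; last exact: mxcont_tr.
by apply: mxcontM => //; exact: mxcont_tr.
Qed.

Lemma mxcont_Ceps : mxcont (Ceps C H Q Rw eps).
Proof.
apply: mxcontD.
  apply: mxcontD; first by apply/mxcontN/mxcont_tr/mxcont_ulsubmx.
  by apply: mxcontM; [apply: mxcontM => //|]; exact: mxcont_tr.
by apply: mxcontM mxcont_Bmx; apply: mxcontM mxcont_Amx mxcont_Mmx.
Qed.

Lemma mxcont_Qeps : mxcont (Qeps C H Q Rw eps).
Proof.
apply: mxcontD.
  apply: mxcontD; last exact: mxcont_cst.
  apply: mxcontN; apply: mxcontZ; first exact: cont_cst.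
  by apply: mxcontM; [apply: mxcontM mxcont_Amx mxcont_Mmx | apply/mxcont_tr/mxcont_Amx].
apply: mxcontZ; first exact: cont_cst.
apply: mxcontD; first exact: mxcont_ulsubmx.
by apply: mxcontM => //; apply: mxcontM => //; exact: mxcont_tr.
Qed.

Lemma mxcont_Phi K : mxcont K -> mxcont (fun t => Phi C H Q Rw eps t K).
Proof.
move=> Kc; apply: mxcont_col_mx => //; apply: mxcontM mxcont_Mmx _.
apply: mxcontD; first by apply: mxcontZ mxcont_Bmx; exact: cont_cst.
by apply: mxcontN; apply: mxcontM => //; apply/mxcont_tr/mxcont_Amx.
Qed.

End coefficient_continuity.

(** The derivative of q - K z along the Hamiltonian system, for K a solution of
the Riccati equation: the quadratic terms cancel. *)
Lemma riccati_defect (R : realType) (r : nat) (K Ce Qe Se : 'M[R]_r)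
    (q z : 'cV[R]_r) :
  - Ce^T *m q + Se *m z
    - ((- (K *m Ce) - Ce^T *m K - K *m Qe *m K + Se) *m z
       + K *m (Ce *m z + Qe *m q))
  = (- Ce^T - K *m Qe) *m (q - K *m z).
Proof.
rewrite !(mulmxBl, mulmxDl, mulmxDr, mulmxBr, mulNmx, mulmxN) -!mulmxA.
by generalize_products; apply/matrixP => i j; rewrite !mxE; lra.
Qed.

Lemma mulmx_closed_loop (R : realType) (r : nat) (K Ce Qe : 'M[R]_r)
    (z z' : 'cV[R]_r) :
  Ce *m z + Qe *m (K *m z) - (Ce *m z' + Qe *m K *m z')
  = (Ce + Qe *m K) *m (z - z').
Proof. by rewrite mulmxA -!mulmxDl -mulmxBr. Qed.

(** * The solution of the filter Riccati equation *)

Section riccati.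
Context {R : realType} (t0 T : R) (r : nat).
Local Notation ode := (ode_solution t0 T).
Local Notation mxcont := (mxcont t0 T).
Variables (K Ce Qe Se : R -> 'M[R]_r).
Hypothesis t0T : t0 <= T.
Hypotheses (Cc : mxcont Ce) (Qc : mxcont Qe).
Hypothesis Q_semidef : forall t, t \in `[t0, T] -> possemidef (Qe t).
Hypothesis S_semidef : forall t, t \in `[t0, T] -> possemidef (Se t).
Hypothesis K0_semidef : possemidef (K t0).
Hypothesis K_riccati : ode K (fun t =>
  - (K t *m Ce t) - (Ce t)^T *m K t - K t *m Qe t *m K t + Se t).

Let Kc : mxcont K := ode_mxcont K_riccati.

Let t0_in : t0 \in `[t0, T].
Proof. by rewrite in_itv/= lexx. Qed.

(** K - K^T solves a homogeneous linear equation. *)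
Lemma riccati_sym t : t \in `[t0, T] -> (K t)^T = K t.
Proof.
move=> tab; apply/esym/eqP; rewrite -subr_eq0; apply/eqP.
pose A t := - (Ce t)^T - (K t)^T *m Qe t.
pose B t := - Ce t - Qe t *m K t.
have Ab : bounded_entries t0 T A.
  apply: mxcont_bounded; apply: mxcontD; apply: mxcontN; first exact: mxcont_tr.
  by apply: mxcontM => //; exact: mxcont_tr.
have Bb : bounded_entries t0 T B.
  apply: mxcont_bounded; apply: mxcontD; apply: mxcontN => //.
  exact: mxcontM.
apply: (@linear_ode_eq0 _ _ _ _ _ A B (fun t => K t - (K t)^T) t0 Ab Bb _ t0_in) => //.
  apply: ode_ext (ode_addmx K_riccati (ode_oppmx (ode_trmx K_riccati))) _.
  apply: ae_true => s sab; rewrite /A /B.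
  have [Qt _] := Q_semidef sab; have [St _] := S_semidef sab.
  rewrite !trmxD !trmxN !trmx_mul !trmxK Qt St.
  rewrite !(mulmxBl, mulmxBr, mulNmx, mulmxN) -!mulmxA.
  by generalize_products; apply/matrixP => i j; rewrite !mxE; lra.
by have [-> _] := K0_semidef; rewrite subrr.
Qed.

(** Here A = Ce + Qe K, and symmetry of K and Qe turns - K Ce - Ce^T K - K Qe K
into - K A - A^T K + K Qe K. *)
Lemma riccati_nonneg (v : 'cV[R]_r) : 0 <= dotv v (K T *m v).
Proof.
pose A t := Ce t + Qe t *m K t.
pose N t := K t *m Qe t *m K t + Se t.
apply: (@riccati_psd _ t0 T _ K A N) => //.
- apply: ode_ext K_riccati _; apply: ae_true => s sab; rewrite /A /N.
  have [Qt _] := Q_semidef sab.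
  rewrite trmxD trmx_mul Qt (riccati_sym sab) mulmxDr mulmxDl !mulmxA.
  by generalize_products; apply/matrixP => i j; rewrite !mxE; lra.
- by apply: mxcontD => //; exact: mxcontM.
- move=> s sab v'; rewrite mulmxDl dotvDr addr_ge0//; last first.
    by have [_] := S_semidef sab; exact.
  rewrite -!mulmxA -{1}(riccati_sym sab) -dotv_mull.
  by have [_] := Q_semidef sab; exact.
- by have [_] := K0_semidef.
Qed.

Lemma riccati_unit : 1%:M + K T \in unitmx.
Proof.
apply: unitmx_pos => x x0; rewrite mulmxDl mul1mx dotvDr ltr_pwDl//.
  by rewrite lt_def dotv_ge0 andbT; apply: contra_neq x0; exact: dotv_eq0.
exact: riccati_nonneg.
Qed.

End riccati.

(** * The filter representation *)

Theorem corollary5 (R : realType) (t0 T : R) (ht : t0 < T)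
    (r a b p : nat)
    (F : 'M[R]_(r + a, r + b))
    (hF : F = block_mx 1%:M 0 0 0)
    (C : R -> 'M[R]_(r + a, r + b)) (hC : {within `[t0, T], continuous C})
    (H : R -> 'M[R]_(p, r + b)) (hH : {within `[t0, T], continuous H})
    (Q0 : 'M[R]_(r + a)) (hQ0 : posdef Q0)
    (Q : R -> 'M[R]_(r + a)) (hQ : forall t, t \in `[t0, T] -> posdef (Q t))
    (hQc : {within `[t0, T], continuous Q})
    (hQic : {within `[t0, T], continuous (fun t => invmx (Q t))})
    (Rw : R -> 'M[R]_p) (hR : forall t, t \in `[t0, T] -> posdef (Rw t))
    (hRc : {within `[t0, T], continuous Rw})
    (hRic : {within `[t0, T], continuous (fun t => invmx (Rw t))})
    (y : R -> 'cV[R]_p) (hy : observation t0 T F C H Rw y)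
    (eps : R) (heps : 0 < eps)
    (l1 : 'cV[R]_r) (l2 : 'cV[R]_a)
    (u : R -> 'cV[R]_p) (q : R -> 'cV[R]_(r + b)) (z : R -> 'cV[R]_(r + a))
    (d : 'cV[R]_(r + a))
    (hu : suboptimal_solution t0 T F C H Q0 Q Rw eps (col_mx l1 l2) u q z d)
    (K : R -> 'M[R]_r)
    (hK : ode_solution t0 T K (fun t =>
            - (K t *m Ceps C H Q Rw eps t) - (Ceps C H Q Rw eps t)^T *m K t
            - K t *m Qeps C H Q Rw eps t *m K t + Seps C H Q Rw eps t))
    (hK0 : K t0 = eps *: Q4tilde Q0)
    (z1 : R -> 'cV[R]_r)
    (hz1 : ode_solution t0 T z1 (fun t =>
             Ceps C H Q Rw eps t *m z1 t
             + Qeps C H Q Rw eps t *m K t *m z1 t))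
    (hz1T : z1 T = invmx (1%:M + K T) *m l1)
    (xh : R -> 'cV[R]_r)
    (hxh : ode_solution t0 T xh (fun t =>
             (- (Ceps C H Q Rw eps t)^T - K t *m Qeps C H Q Rw eps t) *m xh t
             + (Phi C H Q Rw eps t K)^T *m (H t)^T *m Rw t *m y t))
    (hxh0 : xh t0 = 0) :
  estimate t0 T u y
    = dotv (eps^-1 *: (invmx (1%:M + K T) *m xh T)) l1
  /\
  Omega t0 T F Q0 Q Rw u z d
    = eps^-1 * (dotv (z1 T) (K T *m z1 T)
        - \int[lebesgue_measure]_(t in `[t0, T])
            enorm (Phi C H Q Rw eps t K *m z1 t) ^+ 2).
Proof.
have tT := ltW ht.
have Cc := mxcontP hC; have Hc := mxcontP hH; have Rc := mxcontP hRc.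
have Qic := mxcontP hQic; have Ric := mxcontP hRic.
have eps0 : eps != 0 by rewrite gt_eqF.
pose Ce := Ceps C H Q Rw eps; pose Qe := Qeps C H Q Rw eps.
pose Se := Seps C H Q Rw eps.
have Cec : mxcont t0 T Ce by exact: mxcont_Ceps.
have Qec : mxcont t0 T Qe by exact: mxcont_Qeps.
have Qsd t : t \in `[t0, T] -> possemidef (Qe t).
  by move=> tab; apply: Qeps_semidef => //; [exact: hQ | exact: hR].
have Ssd t : t \in `[t0, T] -> possemidef (Se t).
  by move=> tab; apply: Seps_semidef => //; [exact: hQ | exact: hR].
have K0sd : possemidef (K t0).
  rewrite hK0; apply: possemidefZ; first exact: ltW.
  exact/possemidef_submx_schur/posdef_inv.
have Kt t : t \in `[t0, T] -> (K t)^T = K t :=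
  riccati_sym tT Cec Qec Qsd Ssd K0sd hK (t:=t).
have KTu : 1%:M + K T \in unitmx := riccati_unit tT Cec Qec Qsd Ssd K0sd hK.
have Kc : mxcont t0 T K := ode_mxcont hK.
have t0_in : t0 \in `[t0, T] by rewrite in_itv/= lexx.
have T_in : T \in `[t0, T] by rewrite in_itv/= lexx andbT.
have [yL2 _] := hy.
have FtE : F^T = block_mx 1%:M 0 0 0 by rewrite hF tr_block_mx !trmx0 trmx1.
case: hu => uL2 qL2 [Fq_ac _] zL2 [Fz_ac _] zeq qeq ueq fin dker init.
pose q1 t := usubmx (q t); pose z1' t := usubmx (z t).
have FqE : (fun t => F *m q t) = fun t => col_mx (q1 t) 0.
  by apply/funext => t; rewrite hF mul_block_id_col.
have FzE : (fun t => F^T *m z t) = fun t => col_mx (z1' t) 0.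
  by apply/funext => t; rewrite FtE mul_block_id_col.
have Fq t : F *m q t = col_mx (q1 t) 0 by rewrite hF mul_block_id_col.
have Fz t : F^T *m z t = col_mx (z1' t) 0 by rewrite FtE mul_block_id_col.
rewrite FqE in Fq_ac qeq; rewrite FzE in Fz_ac zeq.
(* Upper rows of the two differential equations, and their algebraic lower rows. *)
have [q1ode qalg] := ode_col0 (conj Fq_ac qeq).
have [z1ode zalg] := ode_col0 (conj Fz_ac zeq).
have elim : {ae lebesgue_measure, forall t, t \in `[t0, T] ->
    eps *: u t = Rw t *m H t *m q t /\
    [/\ dsubmx (q t) = Mmx C H Q Rw eps t *m
        (eps *: (Bmx C Q t *m z1' t) - (Amx C H Q Rw t)^T *m q1 t),
      usubmx (- (C t)^T *m z t + (H t)^T *m u t + q t)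
        = Ce t *m z1' t + Qe t *m q1 t &
      usubmx (C t *m q t + eps *: (invmx (Q t) *m z t))
        = - (Ce t)^T *m q1 t + Se t *m z1' t]}.
  have uq := ae_imply2 (fun t h1 h2 (h : t \in `[t0, T]) => conj (h1 h) (h2 h)) ueq qalg.
  apply: ae_imply2 uq zalg => t + + tab => /(_ tab) [h1 h2] /(_ tab) h3.
  by split=> //; apply: eliminate_vector => //; [exact: hQ | exact: hR].
have q1ode' : ode_solution t0 T q1 (fun t => - (Ce t)^T *m q1 t + Se t *m z1' t).
  by apply: ode_ext q1ode _; apply: ae_imply elim => t + tab => /(_ tab) [_ []].
have z1ode' : ode_solution t0 T z1' (fun t => Ce t *m z1' t + Qe t *m q1 t).
  by apply: ode_ext z1ode _; apply: ae_imply elim => t + tab => /(_ tab) [_ []].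
have mpF : mpinv F = block_mx 1%:M 0 0 0 by rewrite hF mpinv_block_id.
have mpFt : mpinv F^T = block_mx 1%:M 0 0 0 by rewrite FtE mpinv_block_id.
have d1 : usubmx d = 0.
  have := dker; rewrite FtE mul_block_id_col -[0 in RHS](@col_mx0 _ r b 1).
  by case/eq_col_mx.
rewrite mpFt Fz Fq mul_block_id_col col_mxKu in init.
(* The Riccati ansatz holds at the initial time, hence at all times. *)
have q1_t0 : q1 t0 = K t0 *m z1' t0.
  by rewrite hK0 -scalemxAl; exact: eliminate_initial d1 init.
have q1E t : t \in `[t0, T] -> q1 t = K t *m z1' t.
  move=> tab; apply/eqP; rewrite -subr_eq0; apply/eqP.
  pose A t := - (Ce t)^T - K t *m Qe t.
  apply: (@linear_ode_eq0 _ t0 T _ _ A (fun=> 0) (fun t => q1 t - K t *m z1' t) t0) => //.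
  - apply: mxcont_bounded; apply: mxcontD; apply: mxcontN; first exact: mxcont_tr.
    exact: mxcontM.
  - by apply: mxcont_bounded; exact: mxcont_cst.
  - apply: ode_ext (ode_addmx q1ode' (ode_oppmx (ode_mulmx hK z1ode'))) _.
    by apply: ae_true => s _; rewrite mulmx0 addr0; exact: riccati_defect.
  - by rewrite q1_t0 subrr.
(* The final condition, and uniqueness backwards from T. *)
have z1_T : z1' T = invmx (1%:M + K T) *m l1.
  have : (1%:M + K T) *m z1' T = l1.
    move: fin; rewrite mpF Fz Fq mul_block_id_col col_mxKu FtE mul_block_id_col col_mxKu.
    rewrite add_col_mx => /eq_col_mx[<- _].
    by rewrite mulmxDl mul1mx -q1E.
  by move=> <-; rewrite mulKmx.
have z1E t : t \in `[t0, T] -> z1' t = z1 t.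
  move=> tab; apply/eqP; rewrite -subr_eq0; apply/eqP.
  pose A t := Ce t + Qe t *m K t.
  apply: (@linear_ode_eq0 _ t0 T _ _ A (fun=> 0) (fun t => z1' t - z1 t) T) => //.
  - by apply: mxcont_bounded; apply: mxcontD => //; exact: mxcontM.
  - by apply: mxcont_bounded; exact: mxcont_cst.
  - apply: ode_ext (ode_addmx z1ode' (ode_oppmx hz1)) _.
    apply: ae_true => s sab; rewrite mulmx0 addr0 (q1E s sab).
    exact: mulmx_closed_loop.
  - by rewrite z1_T hz1T subrr.
have qE : {ae lebesgue_measure, forall t, t \in `[t0, T] ->
    q t = Phi C H Q Rw eps t K *m z1 t}.
  apply: ae_imply elim => t + tab => /(_ tab) [_ [q2E _ _]].
  rewrite -[q t]vsubmxK q2E -/(q1 t) q1E// z1E// /Phi mul_col_mx.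
  congr col_mx; rewrite -[RHS]mulmxA [X in _ = _ *m X]mulmxBl; congr (_ *m (_ - _)).
    by rewrite scalemxAl.
  by rewrite mulmxA.
have uqE : {ae lebesgue_measure, forall t, t \in `[t0, T] ->
    u t = eps^-1 *: (Rw t *m H t *m q t) /\ q t = Phi C H Q Rw eps t K *m z1 t}.
  apply: ae_imply2 ueq qE => t + + tab => /(_ tab) <- /(_ tab) h; split=> //.
  by rewrite scalerA mulVf// scale1r.
split.
  (* The adjoint pair z1 and xh: the terms in Ceps and K Qeps cancel. *)
  have uy : ode_solution t0 T (fun t => eps^-1 * dotv (z1 t) (xh t))
      (fun t => dotv (u t) (y t)).
    apply: ode_ext (ode_scale _ (ode_dotv hz1 hxh)) _.
    apply: ae_imply uqE => t + tab => /(_ tab) [-> ->].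
    have [Qt _] := Qsd t tab; have [Rt _] := hR t tab.
    rewrite -/(Ce t) -/(Qe t) dotvZl; congr (_ * _).
    rewrite dotvDr mulmxBl mulNmx dotvBr dotvNr dotvDl !dotv_mull.
    rewrite !trmx_mul Rt Kt// Qt !mulmxA.
    by rewrite addrC -[X in X + _]addrA addrAC; ring.
  rewrite /estimate (ode_integral tT uy (integrable_dotv uL2 yL2)) hxh0 dotv0 mulr0 subr0.
  rewrite dotvZl dotvC hz1T dotv_mull trmx_inv trmxD trmx1 Kt//.
pose f1 t := dotv (u t) (invmx (Rw t) *m u t).
pose f2 t := dotv (z t) (invmx (Q t) *m z t).
pose f3 t := dotv (Phi C H Q Rw eps t K *m z1 t) (Phi C H Q Rw eps t K *m z1 t).
have i1 := integrable_quadratic uL2 Ric.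
have i2 := integrable_quadratic zL2 Qic.
have i3 : (@lebesgue_measure R).-integrable `[t0, T] (EFin \o f3).
  have Phz : mxcont t0 T (fun t => Phi C H Q Rw eps t K *m z1 t).
    by apply: mxcontM (ode_mxcont hz1); exact: mxcont_Phi.
  by apply: integrable_cont; exact: mxcont_dotv.
have fode : ode_solution t0 T (fun t => dotv (q1 t) (z1' t))
    (fun t => eps * (f1 t + f2 t) + f3 t).
  apply: ode_ext (ode_dotv q1ode z1ode) _.
  have alg := ae_imply2 (fun t h1 h2 (h : t \in `[t0, T]) => conj (h1 h) (h2 h)) qalg zalg.
  apply: ae_imply2 alg uqE => t + + tab => /(_ tab) [qa za] /(_ tab) [uE qPhi].
  have [Rt _] := hR t tab; have Ru := posdef_unit (hR t tab).
  (* One factor has no lower block, so the inner product of the upper blocks is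
     the inner product of the whole vectors, and the terms in C cancel. *)
  have cut k l (x y' : 'cV[R]_(k + l)) : dsubmx x = 0 ->
      dotv (usubmx x) (usubmx y') = dotv x y'.
    move=> x0; rewrite -{2}[x]vsubmxK -{2}[y']vsubmxK dotv_col x0 dot0v addr0//.
  rewrite /q1 /z1' (cut _ _ _ (z t) qa) [dotv (usubmx (q t)) _]dotvC (cut _ _ _ (q t) za).
  rewrite /f3 -qPhi /f1 /f2.
  have HqE : H t *m q t = eps *: (invmx (Rw t) *m u t).
    by rewrite uE -scalemxAr scalerA mulfV// scale1r -mulmxA mulKmx.
  have Hu : dotv ((H t)^T *m u t) (q t) = eps * dotv (u t) (invmx (Rw t) *m u t).
    by rewrite dotv_mull trmxK HqE dotvZr.
  have Cz : dotv ((C t)^T *m z t) (q t) = dotv (C t *m q t) (z t).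
    by rewrite dotv_mull trmxK dotvC.
  rewrite !dotvDl mulNmx dotvNl dotvZl Hu Cz [dotv (invmx _ *m z t) _]dotvC.
  by ring.
have i12 : (@lebesgue_measure R).-integrable `[t0, T] (EFin \o (fun t => f1 t + f2 t)).
  exact: (integrableD _ i1 i2).
have ei12 : (@lebesgue_measure R).-integrable `[t0, T]
    (EFin \o (fun t => eps * (f1 t + f2 t))).
  exact: (integrableZl _ eps i12).
have i123 : (@lebesgue_measure R).-integrable `[t0, T]
    (EFin \o (fun t => eps * (f1 t + f2 t) + f3 t)).
  exact: (integrableD _ ei12 i3).
have := ode_integral tT fode i123.
rewrite RintegralD// RintegralZl// RintegralD//.
rewrite (q1E T T_in) (z1E T T_in) [dotv (K T *m _) _]dotvC => Iode.
(* The boundary term at t0: d has no upper block and F q no lower block. *)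
have e0 : enorm (sqrtmx (invmx Q0) *m (mpinv F^T *m (F^T *m z t0) - d)) ^+ 2
    = eps^-1 * dotv (q1 t0) (z1' t0).
  rewrite enorm_sqrtmx; last exact/posdef_semidef/posdef_inv.
  rewrite mpFt Fz mul_block_id_col col_mxKu -init dotvZr dotvC.
  congr (_ * _); rewrite -[d]vsubmxK d1 opp_col_mx add_col_mx oppr0 addr0 add0r.
  by rewrite dotv_col dot0v addr0.
rewrite /Omega e0.
rewrite (@eq_Rintegral _ _ _ lebesgue_measure _ f1); last first.
  move=> t; rewrite inE => tab; apply: enorm_sqrtmx.
  exact/posdef_semidef/posdef_inv/hR.
rewrite [X in _ + _ + X](@eq_Rintegral _ _ _ lebesgue_measure _ f2); last first.
  move=> t; rewrite inE => tab; apply: enorm_sqrtmx.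
  exact/posdef_semidef/posdef_inv/hQ.
rewrite [X in _ - X](@eq_Rintegral _ _ _ lebesgue_measure _ f3); last first.
  by move=> t _; rewrite enormE.
apply: (mulfI eps0); rewrite [RHS]mulVKf// !mulrDr mulVKf//.
by move: Iode; lra.
Qed.
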